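(* Let $X$ be a semi-Kelley circularly chainable continuum. Then $X$ is a semi-Kelley remainder.
   Context: A continuum is a compact connected metric space with more than one point. A subcontinuum of a continuum $X$ is a non-empty compact connected subset of $X$ (one-point sets are allowed). Convergence of subcontinua is with respect to the Hausdorff metric. A circular chain in $X$ is a non-empty finite collection $\mathcal C=\{U_1,\dots,U_n\}$ of non-empty open sets of $X$ such that $U_i\cap U_j\neq\emptyset$ if and only if $|i-j|\leq 1$ or $\{i,j\}=\{1,n\}$. For $\varepsilon>0$, $\mathcal C$ is an $\varepsilon$-circular chain if $\max\{\mathrm{diam}(U_i):1\leq i\leq n\}<\varepsilon$. A continuum $X$ is circularly chainable if for each $\varepsilon>0$ there is an $\varepsilon$-circular chain covering $X$. A compactification of $(0,1]$ with remainder $R$ is a continuum $Y=(0,1]\cup R$, where $(0,1]$ (a subspace homeomorphic to the half-open interval) is dense in $Y$ and $R$ and $(0,1]$ are disjoint. A continuum $X$ is a semi-Kelley remainder if it is (up to homeomorphism) the remainder of some compactification of $(0,1]$ which is a semi-Kelley continuum. Let $K$ be a subcontinuum of a continuum $Z$. A maximal limit continuum of $K$ is a subcontinuum $M\subset K$ for which there is a sequence $\{M_n\}_{n=1}^\infty$ of subcontinua of $Z$ converging to $M$ such that for each convergent sequence $\{M_n'\}_{n=1}^\infty$ of subcontinua of $Z$ with $M_n\subset M_n'$ for each $n\in\mathbb N$ and $\lim M_n'=M'\subset K$, we have $M'=M$. A continuum $Z$ is semi-Kelley if for each subcontinuum $K$ of $Z$ and every two maximal limit continua $L$ and $M$ of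 $K$, either $L\subset M$ or $M\subset L$. *)

(* Defs.v *)
From HB Require Import structures.
From mathcomp Require Import all_boot all_order all_algebra.
From mathcomp Require Import all_classical all_reals all_analysis.

Set Implicit Arguments.
Unset Strict Implicit.
Unset Printing Implicit Defensive.

Import Order.TTheory GRing.Theory Num.Theory.
Import numFieldNormedType.Exports.

Local Open Scope classical_set_scope.
Local Open Scope ring_scope.

(* [A] and [B], with their subspace topologies, are homeomorphic; only the
   restrictions of [f] to [A] and of [g] to [B] matter. *)
Definition homeomorphic_sets (S T : topologicalType) (A : set S) (B : set T) :=
  exists (f : S -> T) (g : T -> S),
    [/\ set_bij A B f, {in A, cancel f g},
        {within A, continuous f} & {within B, continuous g}].

Section Continua.
Variable R : realType.

Definition is_continuum (X : metricType R) : Prop :=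
  [/\ compact [set: X], connected [set: X] & exists x y : X, x <> y].

Definition subcontinuum (X : metricType R) (A : set X) : Prop :=
  [/\ A !=set0, compact A & connected A].

Definition diam (X : metricType R) (A : set X) : \bar R :=
  ereal_sup [set (mdist p.1 p.2)%:E | p in A `*` A].

Definition set_nbhd (X : metricType R) (r : R) (A : set X) : set X :=
  \bigcup_(a in A) ball a r.

(* The value is finite whenever [A] and [B] are nonempty and bounded. *)
Definition hausdorff_dist (X : metricType R) (A B : set X) : \bar R :=
  ereal_inf [set r%:E | r in
    [set r : R | [/\ 0 < r, A `<=` set_nbhd r B & B `<=` set_nbhd r A]]].

Definition hausdorff_cvg (X : metricType R) (A_ : nat -> set X) (A : set X) :=
  (fun n => hausdorff_dist (A_ n) A) @ \oo --> (0 : \bar R)%E.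

(* The links are numbered 0, ..., n, so that the chain has n + 1 >= 1 links. *)
Definition circular_chain (X : metricType R) (n : nat)
    (U : 'I_n.+1 -> set X) : Prop :=
  (forall i, U i !=set0 /\ open (U i)) /\
  (forall i j : 'I_n.+1,
     U i `&` U j !=set0 <->
     `|(i : nat)%:Z - (j : nat)%:Z| <= 1 \/
     [set i; j] = [set ord0; ord_max]).

Definition eps_circular_chain (X : metricType R) (e : R) (n : nat)
    (U : 'I_n.+1 -> set X) : Prop :=
  circular_chain U /\ forall i, (diam (U i) < e%:E)%E.

Definition circularly_chainable (X : metricType R) : Prop :=
  forall e : R, 0 < e ->
    exists (n : nat) (U : 'I_n.+1 -> set X),
      eps_circular_chain e U /\ \bigcup_i U i = [set: X].

Definition maximal_limit_continuum (Z : metricType R) (K M : set Z) : Prop :=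
  [/\ subcontinuum M, M `<=` K &
    exists M_ : nat -> set Z,
      [/\ forall n, subcontinuum (M_ n), hausdorff_cvg M_ M &
        forall (M'_ : nat -> set Z) (M' : set Z),
          (forall n, subcontinuum (M'_ n)) -> subcontinuum M' ->
          (forall n, M_ n `<=` M'_ n) ->
          hausdorff_cvg M'_ M' -> M' `<=` K -> M' = M]].

Definition semi_Kelley (Z : metricType R) : Prop :=
  forall K L M : set Z, subcontinuum K ->
    maximal_limit_continuum K L -> maximal_limit_continuum K M ->
    L `<=` M \/ M `<=` L.

(* [Y] is a compactification of (0,1], embedded as [J], with remainder [Q]. *)
Definition compactification_with_remainder (Y : metricType R)
    (J Q : set Y) : Prop :=
  [/\ is_continuum Y,
      homeomorphic_sets `]0 : R, 1 : R]%classic J,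
      dense J, J `|` Q = [set: Y] & J `&` Q = set0].

Definition semi_Kelley_remainder (X : metricType R) : Prop :=
  exists (Y : metricType R) (J Q : set Y),
    [/\ compactification_with_remainder J Q, semi_Kelley Y &
        homeomorphic_sets [set: X] Q].

End Continua.

(* Main.v *)
Require Import Defs.
From HB Require Import structures.
From mathcomp Require Import all_boot all_order all_algebra.
From mathcomp Require Import all_classical all_reals all_analysis.
From mathcomp Require Import zify lra.

Set Implicit Arguments.
Unset Strict Implicit.
Unset Printing Implicit Defensive.

Import Order.TTheory GRing.Theory Num.Theory.
Import numFieldNormedType.Exports.

Local Open Scope classical_set_scope.
Local Open Scope ring_scope.

(** A ray is wrapped around [X] along finer and finer covers. If [X] is linearly
chainable, the cover of each level is a chain run back and forth; otherwise it
is a circular chain run around forever, and then every arc of a sufficiently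
fine chain is crossed by a subcontinuum, since a separation of the arc would
unroll the circle into a linear chain. Passing from one level to the next, the
walk through the finer cover starts at a minimum of its projection to the
coarser one, so that it never backtracks below its starting index. Hence every
piece of the ray is close to a subcontinuum [A] of [X], and every subcontinuum
containing [A] is close to a larger piece of the ray.

In the compactification [Y] the subcontinua meeting the ray are the slices
[a <= height <= b]; such a slice is its only maximal limit continuum. For [K]
inside [X], replacing pieces of the ray by the subcontinua of [X] close to them
turns maximal limit continua of [K] in [Y] into maximal limit continua of [K]
in [X], which are nested because [X] is semi-Kelley. *)

(** * Connected and compact sets *)

(** Maximality of a limit continuum speaks of all larger subcontinua, so mutual approximation of
    subcontinua and pieces of the ray is not enough: an enlargement of the subcontinuum must be
    matched by an enlargement of the same piece of ray. On an interval of links, enlarging means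
    adding links at both ends. Links on the right are reached by running the walk on, links on the
    left only by going back in time, into the part of the ray that follows coarser covers. This is
    why a level must start at a minimum of its projection: the coarse index equals time up to that
    start and never falls below it afterwards, so going back adds exactly the missing links. If the
    level is exhausted on the left, the argument is repeated one level coarser; if that level is
    exhausted too, the set meets a full period of its links and is close to [X]. The error grows by
    one level only, hence still tends to 0. *)

Section ConnectedCompact.
Variable T : topologicalType.
Implicit Types A B C D K E F : set T.

Lemma connected_split_closed A C D : connected A -> closed C -> closed D ->
  A `<=` C `|` D -> A `&` (C `&` D) = set0 -> A `<=` C \/ A `<=` D.
Proof.
move=> cA clC clD AU AI.
have sep : separated (A `&` C) (A `&` D).
  split; rewrite -subset0 => x.
    move=> [/closureI[_ cx] [Ax Dx]].
    by rewrite -AI; split=> //; split=> //; move/closure_id: clC => ->.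
  move=> [[Ax Cx] /closureI[_ dx]].
  by rewrite -AI; split=> //; split=> //; move/closure_id: clD => ->.
have sub : A `<=` (A `&` C) `|` (A `&` D).
  by move=> x Ax; have [?|?] := AU _ Ax; [left|right].
have [h|h] := connected_subset sep sub cA; [left|right];
  by move=> x /h[].
Qed.

Lemma connected_split_open A C D : connected A -> open C -> open D ->
  A `<=` C `|` D -> A `&` (C `&` D) = set0 -> A `<=` C \/ A `<=` D.
Proof.
move=> cA oC oD AU AI.
have [||||AD|AC] := @connected_split_closed A (~` C) (~` D) cA.
- exact: open_closedC.
- exact: open_closedC.
- by move=> x Ax; apply: contrapT => /not_orP[/contrapT ? /contrapT ?];
    have : (A `&` (C `&` D)) x by []; rewrite AI.
- by rewrite -subset0 => x [/AU[]? []].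
- by right=> x Ax; have [/(AD _ Ax)|] := AU _ Ax.
- by left=> x Ax; have [|/(AC _ Ax)] := AU _ Ax.
Qed.

(** The traces on [K] generate a proper filter; any cluster point of it lies in all the closed
    sets. *)
Lemma directed_compact K (D : set (set T)) : compact K -> D !=set0 ->
  (forall A, D A -> closed A) ->
  (forall A B, D A -> D B -> exists2 C, D C & C `<=` A `&` B) ->
  (forall A, D A -> K `&` A !=set0) ->
  exists2 x, K x & forall A, D A -> A x.
Proof.
move=> cK [A0 DA0] clD dirD meet.
pose F := filter_from D (fun A => K `&` A).
have FF : ProperFilter F.
  apply: filter_from_proper => //; apply: filter_from_filter; first by exists A0.
  move=> A B DA DB; have [C DC CAB] := dirD _ _ DA DB.
  by exists C => // x [Kx /CAB[]].
have [|x [Kx clx]] := cK F FF; first by exists A0 => // x [].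
exists x => // A DA; apply: (clD _ DA) => U nU.
have FA : F A by exists A => // y [].
by have [y [Ay Uy]] := clx _ _ FA nU; exists y.
Qed.

(** Relative clopenness, expressed by closed sets of the ambient space; for closed [K] this is the
    same as being clopen in [K]. *)
Definition clopen_part K C := [/\ C `<=` K, closed C & closed (K `\` C)].

Lemma clopen_partI K A B :
  clopen_part K A -> clopen_part K B -> clopen_part K (A `&` B).
Proof.
move=> [AK clA clA'] [BK clB clB']; split; first by move=> x [/AK].
- exact: closedI.
- by rewrite setDIr; exact: closedU.
Qed.

Lemma clopen_partD K A : clopen_part K A -> clopen_part K (K `\` A).
Proof.
by move=> [AK clA clA']; split=> //; rewrite setDD; have -> : K `&` A = A
  by apply/setIidPr.
Qed.

Definition quasi_component K x := [set y | forall C, clopen_part K C -> C x -> C y].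

End ConnectedCompact.

(** * Quasi-components and the cut-wire theorem *)

Section CutWire.
Variables (R : realType) (T : metricType R).
Implicit Types A B C D K E F : set T.
Hypothesis cT : compact [set: T].

(** Normality puts the halves of a separation into disjoint open sets [U] and [V], and compactness
    yields a clopen part around [x] inside their union. Its trace on whichever of [U], [V] contains
    [x] is again a clopen part, and it misses one of the halves. *)
Lemma quasi_component_connected K x : closed K -> K x ->
  connected (quasi_component K x).
Proof.
move=> clK Kx.
set Q := quasi_component K x.
have KK : clopen_part K K by split=> //; rewrite setDv; exact: closed0.
have QK : Q `<=` K by move=> y; apply.
have Qx : Q x by [].
have clQ : closed Q.
  have -> : Q = \bigcap_(C in [set C | clopen_part K C /\ C x]) C.
    apply/seteqP; split=> [y Qy C [kC Cx]|y h C kC Cx]; first exact: Qy.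
    by apply: h.
  by apply: closed_bigI => C [[_ ? _] _].
apply: contrapT => /connectedPn[E [E0 QE [sE1 sE2]]].
have clE b : closed (E b).
  have EQ : E b `<=` Q by rewrite QE; case: b => y ?; [right|left].
  move=> y cy; have Qy : Q y by apply: clQ; exact: (closureS EQ).
  move: Qy cy; rewrite QE; case: b {EQ} => -[Ey|Ey] // cy.
    by have : (E false `&` closure (E true)) y by []; rewrite sE2.
  by have : (closure (E false) `&` E true) y by []; rewrite sE1.
have EE : E false `&` E true = set0 by exact: separated_disjoint.
have /(@normal_openP R) := compact_normal (@metric_hausdorff _ T) cT.
move=> /(_ _ _ (clE false) (clE true) EE)[U [V [oU oV EU EV UV]]].
pose D := [set C | clopen_part K C /\ C x].
have : exists2 C, D C & C `<=` U `|` V.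
  apply: contrapT => noC.
  have [|||||y nUV yD] := @directed_compact _ (~` (U `|` V)) D.
  - apply: (@subclosed_compact _ _ setT) => //.
    by apply: open_closedC; exact: openU.
  - by exists K.
  - by move=> A [[_ ? _] _].
  - move=> A B [kA Ax] [kB Bx]; exists (A `&` B) => //.
    by split=> //; exact: clopen_partI.
  - move=> A DA; apply: contrapT => h; apply: noC; exists A => // y Ay.
    by apply: contrapT => nUV; apply: h; exists y.
  - apply: nUV; have : Q y by move=> C kC Cx; apply: yD.
    by rewrite QE => -[/EU|/EV]; [left|right].
move=> [C [[CK clC clC'] Cx] CUV].
have part W W' : open W -> open W' -> W `&` W' = set0 -> C `<=` W `|` W' ->
    clopen_part K (C `&` W).
  move=> oW oW' WW' CWW'.
  have CW : C `&` W = C `&` ~` W'.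
    apply/seteqP; split=> y [Cy Wy]; split=> //.
      by move=> W'y; have : (W `&` W') y by []; rewrite WW'.
    by have [] := CWW' _ Cy.
  split; first by move=> y [/CK].
    by rewrite CW; apply: closedI => //; exact: open_closedC.
  have -> : K `\` (C `&` W) = (K `\` C) `|` (K `&` ~` W).
    by rewrite setDIr.
  by apply: closedU => //; apply: closedI => //; exact: open_closedC.
have kU : clopen_part K (C `&` U) by apply: (part _ V).
have kV : clopen_part K (C `&` V).
  by apply: (part _ U) => //; [rewrite setIC|rewrite setUC].
have [y0 Ey0] := E0 false; have [y1 Ey1] := E0 true.
have Q0 : Q y0 by rewrite QE; left.
have Q1 : Q y1 by rewrite QE; right.
have [Ux|Vx] := CUV _ Cx.
  have [_ Uy1] := Q1 _ kU (conj Cx Ux).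
  have : (U `&` V) y1 by split=> //; exact: EV.
  by rewrite UV.
have [_ Vy0] := Q0 _ kV (conj Cx Vx).
have : (U `&` V) y0 by split=> //; exact: EU.
by rewrite UV.
Qed.

(* The cut-wire theorem. *)
Lemma connected_or_clopen K E F : closed K -> closed E -> closed F ->
  E `<=` K -> F `<=` K ->
  (exists A, [/\ connected A, closed A, A `<=` K, A `&` E !=set0 & A `&` F !=set0])
  \/ (exists C, [/\ clopen_part K C, E `<=` C & C `&` F = set0]).
Proof.
move=> clK clE clF EK FK.
have cpt A : closed A -> compact A.
  by move=> clA; exact: (subclosed_compact clA cT).
have [[C [kC EC CF]]|no] := pselect (exists C, [/\ clopen_part K C, E `<=` C & C `&` F = set0]).
  by right; exists C.
left.
(* Compactness is used twice: [y] in [F] lies in every clopen part containing [E], and then some [x]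
   in [E] lies in every clopen part containing [y], since the complement of a clopen part disjoint
   from [E] is one that contains [E]. The quasi-component of [y] thus joins [E] to [F]. *)
have [||||y Fy yD] := @directed_compact _ F [set C | clopen_part K C /\ E `<=` C] (cpt _ clF).
- by exists K; split=> //; split=> //; rewrite setDv; exact: closed0.
- by move=> A [[_ ? _] _].
- move=> A B [kA EA] [kB EB]; exists (A `&` B) => //; split.
    exact: clopen_partI.
  by move=> x Ex; split; [exact: EA|exact: EB].
- move=> C [kC EC]; apply: contrapT => h; apply: no; exists C; split=> //.
  by rewrite -subset0 => x [Cx Fx]; apply: h; exists x.
have Ky := FK _ Fy.
have [||||x Ex xQ] := @directed_compact _ E [set C | clopen_part K C /\ C y] (cpt _ clE).
- by exists K; split=> //; split=> //; rewrite setDv; exact: closed0.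
- by move=> A [[_ ? _] _].
- move=> A B [kA Ay] [kB By]; exists (A `&` B) => //.
  by split=> //; exact: clopen_partI.
- move=> C [kC Cy]; apply: contrapT => h.
  have [|//] := yD (K `\` C); split; first exact: clopen_partD.
  by move=> x Ex; split; [exact: EK|move=> Cx; apply: h; exists x].
exists (quasi_component K y); split.
- exact: quasi_component_connected.
- have -> : quasi_component K y = \bigcap_(C in [set C | clopen_part K C /\ C y]) C.
    apply/seteqP; split=> [z Qz C [kC Cx]|z h C kC Cx]; first exact: Qz.
    by apply: h.
  by apply: closed_bigI => C [[_ ? _] _].
- by move=> z; apply=> //; split=> //; rewrite setDv; exact: closed0.
- by exists x; split=> // C kC Cy; apply: xQ.
- by exists y; split.
Qed.

End CutWire.

(** * Metric preliminaries *)

Section MetricPrelim.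
Variables (R : realType) (X : metricType R).
Implicit Types (A B : set X) (e r : R).
Local Notation d := (@mdist R X).

Lemma near_mdistP (x : X) (P : X -> Prop) :
  (\near x, P x) <-> exists2 r, 0 < r & forall y, d x y < r -> P y.
Proof. exact: metricType_numDomainType.nbhs_mdistP. Qed.

Lemma open_mdistP (U : set X) :
  open U <-> forall x, U x -> exists2 r, 0 < r & forall y, d x y < r -> U y.
Proof.
rewrite openE; split=> h x Ux.
  by have /near_mdistP := h _ Ux.
by apply/near_mdistP; apply: h.
Qed.

Lemma closure_mdistP A x :
  closure A x <-> forall r, 0 < r -> exists2 y, A y & d x y < r.
Proof.
split=> [cx r r0|h U /near_mdistP[r r0 rU]].
  have [|y [Ay yr]] := cx [set y | d x y < r]; last by exists y.
  by apply/near_mdistP; exists r.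
by have [y Ay xy] := h r r0; exists y; split=> //; exact: rU.
Qed.

Lemma compact_subset_closed A : compact A -> closed A.
Proof. exact: (compact_closed (@metric_hausdorff _ X)). Qed.

Lemma closed_separate A x : closed A -> ~ A x ->
  exists2 r, 0 < r & forall y, A y -> r <= d x y.
Proof.
move=> clA nAx.
have /open_mdistP/(_ _ nAx)[r r0 rA] := closed_openC clA.
by exists r => // y Ay; rewrite leNgt; apply/negP => /rA.
Qed.

(** Hausdorff closeness with explicit witnesses, free of infima and extended reals; the weak
    inequality makes the errors add up under composition. *)
Definition hclose e A B :=
  (forall a, A a -> exists2 b, B b & d a b <= e) /\
  (forall b, B b -> exists2 a, A a & d a b <= e).

Lemma hclose_sym e A B : hclose e A B -> hclose e B A.
Proof.
move=> [h1 h2]; split=> x.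
  by move=> /h2[a Aa]; rewrite metric_sym; exists a.
by move=> /h1[a Aa]; rewrite metric_sym; exists a.
Qed.

Lemma hclose_refl e A : 0 <= e -> hclose e A A.
Proof. by move=> e0; split=> x Ax; exists x => //; rewrite mdistxx. Qed.

Lemma hclose_trans e1 e2 A B C :
  hclose e1 A B -> hclose e2 B C -> hclose (e1 + e2) A C.
Proof.
move=> [h1 h2] [k1 k2]; split=> [a /h1[b /k1[c Cc bc] ab]|c /k2[b /h2[a Aa ab] bc]].
  by exists c => //; rewrite (le_trans (metric_triangle _ b _))// lerD.
by exists a => //; rewrite (le_trans (metric_triangle _ b _))// lerD.
Qed.

Lemma hclose_le e1 e2 A B : e1 <= e2 -> hclose e1 A B -> hclose e2 A B.
Proof.
move=> e12 [h1 h2]; split=> [a /h1[b Bb ab]|b /h2[a Aa ab]].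
  by exists b => //; exact: le_trans e12.
by exists a => //; exact: le_trans e12.
Qed.

Lemma hausdorff_dist_hclose e A B :
  (hausdorff_dist A B < e%:E)%E -> hclose e A B.
Proof.
move=> /ereal_inf_lt[_ [r [r0 rA rB] <-]]; rewrite lte_fin => re.
split=> [a /rA[b Bb]|b /rB[a Aa]]; rewrite ballEmdist/= => h.
  by exists b => //; rewrite metric_sym; apply: ltW; exact: lt_trans re.
by exists a => //; apply: ltW; exact: lt_trans re.
Qed.

Lemma hclose_hausdorff_dist e e' A B : 0 < e' -> e < e' ->
  hclose e A B -> (hausdorff_dist A B <= e'%:E)%E.
Proof.
move=> e0 ee' [h1 h2]; apply: ge_ereal_inf; exists e'%:E => //; exists e' => //; split=> //.
- move=> a /h1[b Bb ab]; exists b => //.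
  by rewrite ballEmdist/= metric_sym; exact: le_lt_trans ee'.
- move=> b /h2[a Aa ab]; exists a => //.
  by rewrite ballEmdist/=; exact: le_lt_trans ee'.
Qed.

Lemma hausdorff_dist_ge0 A B : (0 <= hausdorff_dist A B)%E.
Proof.
by apply: le_ereal_inf_tmp => _ [r [r0 _ _] <-]; rewrite lee_fin ltW.
Qed.

Lemma hausdorff_cvgP (A_ : nat -> set X) A : hausdorff_cvg A_ A <->
  forall e, 0 < e -> \forall n \near \oo, hclose e (A_ n) A.
Proof.
split=> [cvA e e0|h].
  have := cvA [set u : \bar R | (u < e%:E)%E].
  have nb : nbhs (0 : \bar R)%E [set u : \bar R | (u < e%:E)%E].
    by apply: open_ereal_lt'; rewrite lte_fin.
  by move=> /(_ nb) [N _ hN]; exists N => // n /hN; exact: hausdorff_dist_hclose.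
move=> U /nbhs_EFin /nbhs_ballP[e /= e0 eU].
have e20 : 0 < e / 2 / 2 by lra.
have [N _ hN] := h _ e20; exists N => // n /hN hc.
have := hausdorff_dist_ge0 (A_ n) A.
have : (hausdorff_dist (A_ n) A <= (e / 2)%:E)%E.
  by apply: hclose_hausdorff_dist hc; lra.
rewrite /=; case: hausdorff_dist => [r||] //=; rewrite !lee_fin => re r0.
by apply: eU; rewrite /ball/= sub0r normrN ger0_norm//; lra.
Qed.

Lemma lebesgue_number (I : Type) (U : I -> set X) : compact [set: X] ->
  (forall i, open (U i)) -> (forall x, exists i, U i x) ->
  exists2 r, 0 < r & forall x, exists i, forall y, d x y < r -> U i y.
Proof.
move=> /compact_near_coveringP cX oU cov.
have := cX R (0 : R)^'+ (fun r x => exists i, forall y, d x y < r -> U i y).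
case=> [|r /= r0 h].
  move=> x _; have [i Uix] := cov x.
  have [r r0 rU] := (open_mdistP _).1 (oU i) x Uix.
  exists ([set y | d x y < r / 2], [set s | s < r / 2]).
    split=> /=; first by apply/near_mdistP; exists (r / 2) => //; lra.
    by apply: nbhs_right_lt; lra.
  move=> [y s]/= [xy sr]; exists i => z yz; apply: rU.
  by have := metric_triangle x y z; lra.
exists (r / 2); first by move: r0 => /=; lra.
by move=> x; apply: (h (r / 2)) => //=; [rewrite sub0r normrN ger0_norm; lra|lra].
Qed.

(** Thickening by [r] creates no new intersections. Near a point [x], take less than half the
    distance from [x] to every [G i] that misses it: two sets coming this close to a common point
    near [x] both contain [x]. Compactness makes the radius uniform. *)
Lemma thicken_finite (I : finType) (G : I -> set X) : compact [set: X] ->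
  (forall i, closed (G i)) ->
  exists2 r, 0 < r & forall i j, forall g h x,
    G i g -> G j h -> d g x < r -> d h x < r -> exists z, G i z /\ G j z.
Proof.
move=> /compact_near_coveringP cX clG.
have := cX R (0 : R)^'+ (fun r x => forall i j, forall g h,
    G i g -> G j h -> d g x < r -> d h x < r -> exists z, G i z /\ G j z).
case=> [|r /= r0 h].
  move=> x _.
  have /choice[f fP] i : exists r, 0 < r /\ (G i x \/ forall y, G i y -> r <= d x y).
    have [Gix|nG] := pselect (G i x); first by exists 1; split=> //; left.
    by have [r r0 rG] := closed_separate (clG i) nG; exists r; split=> //; right.
  pose m := \big[Order.min/1]_i f i.
  have m0 : 0 < m.
    rewrite /m; elim/big_ind: _ => // [a b a0 b0|i _]; last by have [] := fP i.
    by rewrite lt_min a0.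
  have mf i : m <= f i by rewrite /m; apply: bigmin_le_cond.
  exists ([set y | d x y < m / 2], [set s | s < m / 2]).
    split=> /=; first by apply/near_mdistP; exists (m / 2) => //; lra.
    by apply: nbhs_right_lt; lra.
  move=> [y s]/= [xy sm] i j g h Gg Gh gy hy; exists x.
  split; apply: contrapT => nG.
    have [_ [//|/(_ _ Gg)]] := fP i; have := mf i.
    by have := metric_triangle x y g; rewrite (metric_sym y g); lra.
  have [_ [//|/(_ _ Gh)]] := fP j; have := mf j.
  by have := metric_triangle x y h; rewrite (metric_sym y h); lra.
exists (r / 2); first by move: r0 => /=; lra.
move=> i j g k x; apply: (h (r / 2)) => //=; last by lra.
by rewrite sub0r normrN ger0_norm; lra.
Qed.

End MetricPrelim.

(** * Integer walks *)

Section IntWalks.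
Implicit Types (N a b c k p q r s t u : int).

(* The wave 0, 1, ..., N, N, ..., 1, 0, 0, 1, ... folding the integers onto
   the indices of a linear chain. *)
Definition zig N t : int :=
  let r := (t %% (2 * N + 2))%Z in if r <= N then r else 2 * N + 1 - r.

(** The window is one ascending run with the descending runs on both sides of it, a period and a
    half, so that facts about the wave near an ascending run become linear arithmetic. *)
Lemma zig_at N k u : 0 <= N -> -1 - N <= u <= 2 * N + 1 ->
  zig N (k * (2 * N + 2) + u) =
  if u < 0 then -1 - u else if u <= N then u else 2 * N + 1 - u.
Proof.
move=> N0 hu; rewrite /zig.
have [u0|u0] := ltP u 0.
  have -> : k * (2 * N + 2) + u = (k - 1) * (2 * N + 2) + (2 * N + 2 + u) by lia.
  rewrite modzMDl modz_small; last by lia.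
  by case: ifP; lia.
rewrite modzMDl modz_small; last by lia.
by case: ifP; lia.
Qed.

Lemma zig_split N t : 0 <= N -> exists k r, 0 <= r <= N /\
  (t = k * (2 * N + 2) + r \/ t = k * (2 * N + 2) - 1 - r).
Proof.
move=> N0; have := divz_eq t (2 * N + 2).
have := modz_ge0 t (d := 2 * N + 2); have := ltz_pmod t (d := 2 * N + 2).
set k := (t %/ _)%Z; set r := (t %% _)%Z => h1 h2 tE.
have [rN|Nr] := leP r N.
  by exists k, r; split; [lia|left].
by exists (k + 1), (2 * N + 1 - r); split; [lia|right; lia].
Qed.

Lemma zig_range N t : 0 <= N -> 0 <= zig N t <= N.
Proof.
move=> N0; rewrite /zig.
have := modz_ge0 t (d := 2 * N + 2); have := ltz_pmod t (d := 2 * N + 2).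
by case: ifP; lia.
Qed.

Lemma zig_periodic N t : zig N (t + (2 * N + 2)) = zig N t.
Proof. by rewrite /zig modzDr. Qed.

Lemma zig_step N t : 0 <= N -> `|zig N (t + 1) - zig N t| <= 1.
Proof.
move=> N0; have [k [r [r0 [->|->]]]] := zig_split t N0.
  have -> : k * (2 * N + 2) + r + 1 = k * (2 * N + 2) + (r + 1) by lia.
  by rewrite !zig_at//; [repeat case: ifP; lia|lia|lia].
have -> : k * (2 * N + 2) - 1 - r + 1 = k * (2 * N + 2) + (- r) by lia.
have -> : k * (2 * N + 2) - 1 - r = k * (2 * N + 2) + (- 1 - r) by lia.
by rewrite !zig_at//; [repeat case: ifP; lia|lia|lia].
Qed.

(** The axis of reflection lies between -1 and 0 because the wave repeats its end values. The
    symmetry exchanges ascending and descending runs. *)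
Lemma zig_opp N t : 0 <= N -> zig N (-1 - t) = zig N t.
Proof.
move=> N0; have [k [r [r0 [->|->]]]] := zig_split t N0.
  have -> : -1 - (k * (2 * N + 2) + r) = (- k) * (2 * N + 2) + (-1 - r) by lia.
  by rewrite !zig_at//; [repeat case: ifP; lia|lia|lia].
have -> : -1 - (k * (2 * N + 2) - 1 - r) = (- k) * (2 * N + 2) + r by lia.
have -> : k * (2 * N + 2) - 1 - r = k * (2 * N + 2) + (- 1 - r) by lia.
by rewrite !zig_at//; [repeat case: ifP; lia|lia|lia].
Qed.

(** The excursion within [[a, b]] through an ascending time is the ascending stretch from [a] to
    [b], continued by its mirror image wherever [a] is 0 or [b] is [N]; this gives the four cases.
    Any interval with values in [[a, b]] through that time lies inside the excursion. *)
Lemma zig_extend_asc N a b p q k r : 0 <= a <= b -> b <= N -> 0 <= r <= N ->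
  p <= k * (2 * N + 2) + r <= q ->
  (forall t, p <= t <= q -> a <= zig N t <= b) ->
  exists p' q', [/\ p' <= p, q <= q', forall t, p' <= t <= q' -> a <= zig N t <= b &
    forall c, a <= c <= b -> exists2 t, p' <= t <= q' & zig N t = c].
Proof.
move=> hab bN hr hpq h; set B := k * (2 * N + 2) in hpq.
have N0 : 0 <= N by lia.
have zB u : -1 - N <= u <= 2 * N + 1 -> zig N (B + u) =
    if u < 0 then -1 - u else if u <= N then u else 2 * N + 1 - u.
  exact: zig_at.
have zt t : -1 - N <= t - B <= 2 * N + 1 -> zig N t =
    if t - B < 0 then -1 - (t - B) else if t - B <= N then t - B
    else 2 * N + 1 - (t - B).
  by move=> ht; rewrite -zB//; congr zig; lia.
have onto p' q' : p' <= B + a -> B + b <= q' ->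
    forall c, a <= c <= b -> exists2 t, p' <= t <= q' & zig N t = c.
  move=> h1 h2 c hc; exists (B + c); first by lia.
  by rewrite zB; [repeat case: ifP; lia|lia].
have hB : a <= r <= b.
  have := h _ hpq; rewrite zB; last by lia.
  by repeat case: ifP; lia.
have [a0|a0] := ltP 0 a.
  have lp : B + a <= p.
    rewrite leNgt; apply/negP => pa; have := h (B + (a - 1)).
    rewrite zB; last by lia.
    by repeat case: ifP; lia.
  have [bN'|bN'] := ltP b N.
    have lq : q <= B + b.
      rewrite leNgt; apply/negP => qa; have := h (B + (b + 1)).
      rewrite zB; last by lia.
      by repeat case: ifP; lia.
    exists (B + a), (B + b); split => // [t ht|]; last by apply: onto.
    by rewrite zt; [repeat case: ifP; lia|lia].
  have lq : q <= B + (2 * N + 1 - a).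
    rewrite leNgt; apply/negP => qa; have := h (B + (2 * N + 2 - a)).
    rewrite zB; last by lia.
    by repeat case: ifP; lia.
  exists (B + a), (B + (2 * N + 1 - a)); split => // [t ht|]; last by apply: onto; lia.
  by rewrite zt; [repeat case: ifP; lia|lia].
have [bN'|bN'] := ltP b N.
  have lp : B + (- 1 - b) <= p.
    rewrite leNgt; apply/negP => pa; have := h (B + (- 2 - b)).
    rewrite zB; last by lia.
    by repeat case: ifP; lia.
  have lq : q <= B + b.
    rewrite leNgt; apply/negP => qa; have := h (B + (b + 1)).
    rewrite zB; last by lia.
    by repeat case: ifP; lia.
  exists (B + (- 1 - b)), (B + b); split => // [t ht|]; last by apply: onto; lia.
  by rewrite zt; [repeat case: ifP; lia|lia].
(* Here [a] is 0 and [b] is [N], so there is no constraint; one more period on each side contains a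
   whole ascending run. *)
exists (p - (2 * N + 2)), (q + (2 * N + 2)); split; [lia|lia| |].
  by move=> t _; have := zig_range t N0; lia.
by apply: onto; lia.
Qed.

Lemma zig_extend N a b p q : 0 <= a <= b -> b <= N -> p <= q ->
  (forall t, p <= t <= q -> a <= zig N t <= b) ->
  exists p' q', [/\ p' <= p, q <= q', forall t, p' <= t <= q' -> a <= zig N t <= b &
    forall c, a <= c <= b -> exists2 t, p' <= t <= q' & zig N t = c].
Proof.
move=> hab bN pq h; have N0 : 0 <= N by lia.
have [k [r [r0 [pE|pE]]]] := zig_split p N0.
  by apply: (@zig_extend_asc N a b p q k r) => //; rewrite -pE; lia.
have [|||||p' [q' [p'p qq' h1 h2]]] :=
    @zig_extend_asc N a b (-1 - q) (-1 - p) (- k) r => //.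
- by rewrite pE; lia.
- by move=> t ht; rewrite -zig_opp//; apply: h; lia.
exists (-1 - q'), (-1 - p'); split; [lia|lia| |].
  by move=> t ht; rewrite -zig_opp//; apply: h1; lia.
move=> c /h2[t ht tc]; exists (-1 - t); first by lia.
by rewrite zig_opp.
Qed.

Lemma int_ge_ind (P : int -> Prop) a : P a ->
  (forall t, a <= t -> P t -> P (t + 1)) -> forall t, a <= t -> P t.
Proof.
move=> Pa Ps t at_; have -> : t = a + `|t - a|%N%:Z by lia.
elim: `|t - a|%N => [|n IH]; first by rewrite addr0.
have -> : a + n.+1%:Z = a + n%:Z + 1 by lia.
by apply: Ps => //; lia.
Qed.

Lemma int_min (P : int -> Prop) a t : a <= t -> P t ->
  exists s, [/\ a <= s <= t, P s & forall u, a <= u < s -> ~ P u].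
Proof.
move=> at_ Pt; have ex : exists n : nat, `[< P (a + n%:Z) >].
  by exists `|t - a|%N; apply/asboolP; have -> : a + `|t - a|%N%:Z = t by lia.
have [n /asboolP Pn nmin] := ex_minnP ex.
have nt : (n <= `|t - a|)%N.
  by apply: nmin; apply/asboolP; have -> : a + `|t - a|%N%:Z = t by lia.
exists (a + n%:Z); split=> //; first by lia.
move=> u hu Pu; have := nmin `|u - a|%N.
have -> : a + `|u - a|%N%:Z = u by lia.
by move/asboolP: Pu => -> /(_ isT); lia.
Qed.

Lemma int_max (P : int -> Prop) b t : t <= b -> P t ->
  exists s, [/\ t <= s <= b, P s & forall u, s < u <= b -> ~ P u].
Proof.
move=> tb Pt; have [||s [h1 h2 h3]] := @int_min (fun u => P (- u)) (- b) (- t).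
- by lia.
- by rewrite opprK.
exists (- s); split=> //; first by lia.
by move=> u hu; have := h3 (- u); rewrite opprK; apply; lia.
Qed.

(** Discrete intermediate value theorem: at the first time the walk is at least [c], a unit step
    leaves no room to exceed [c]. *)
Lemma walk_onto (w : int -> int) a b c : a <= b ->
  (forall t, a <= t < b -> `|w (t + 1) - w t| <= 1) ->
  w a <= c <= w b -> exists2 t, a <= t <= b & w t = c.
Proof.
move=> ab st hc.
have [||s [hs ws smin]] := @int_min (fun t => c <= w t) a b => //; first by lia.
exists s => //; have [sa|sa] := eqVneq s a; first by rewrite sa in ws *; lia.
have := smin (s - 1); have := st (s - 1); rewrite subrK => h1 h2.
have {}h1 := h1 ltac:(lia); have {}h2 := h2 ltac:(lia); lia.
Qed.

Lemma walk_first (w : int -> int) a b c : a <= b ->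
  (forall t, a <= t < b -> `|w (t + 1) - w t| <= 1) -> w a <= c <= w b ->
  exists s, [/\ a <= s <= b, w s = c & forall u, a <= u <= s -> w u <= c].
Proof.
move=> ab st hc.
have [||s [hs ws smin]] := @int_min (fun t => c <= w t) a b => //; first by lia.
have wsc : w s = c.
  have [sa|sa] := eqVneq s a; first by rewrite sa in ws *; lia.
  have := smin (s - 1); have := st (s - 1); rewrite subrK => h1 h2.
  by have {}h1 := h1 ltac:(lia); have {}h2 := h2 ltac:(lia); lia.
exists s; split=> // u hu; have [->|us] := eqVneq u s; first by lia.
by have := smin u; lia.
Qed.

Lemma walk_max (w : int -> int) a b : a <= b ->
  exists2 s, a <= s <= b & forall t, a <= t <= b -> w t <= w s.
Proof.
move: b; apply: int_ge_ind => [|b ab [s hs smax]].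
  by exists a; [lia|move=> t ht; have -> : t = a by lia].
have [h|h] := leP (w (b + 1)) (w s).
  exists s; first by lia.
  by move=> t ht; have [->//|tb] := eqVneq t (b + 1); apply: smax; lia.
exists (b + 1); first by lia.
move=> t ht; have [->//|tb] := eqVneq t (b + 1).
by apply: le_trans (ltW h); apply: smax; lia.
Qed.

Lemma walk_min (w : int -> int) a b : a <= b ->
  exists2 s, a <= s <= b & forall t, a <= t <= b -> w s <= w t.
Proof.
move=> ab; have [s hs smax] := walk_max (fun t => - w t) ab.
by exists s => // t ht; have := smax t ht; lia.
Qed.

Lemma walk_range (w : int -> int) p q : p <= q ->
  (forall t, `|w (t + 1) - w t| <= 1) -> exists a b,
    [/\ a <= b, forall t, p <= t <= q -> a <= w t <= b &
     forall c, a <= c <= b -> exists2 t, p <= t <= q & w t = c].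
Proof.
move=> pq st; have [s hs smin] := walk_min w pq; have [u hu umax] := walk_max w pq.
exists (w s), (w u); split; first by apply: smin.
  by move=> t ht; rewrite smin// umax.
move=> c hc; have [su|us] := leP s u.
  have [||t ht <-] := @walk_onto w s u c su => //.
  by exists t => //; lia.
(* The maximum precedes the minimum, so time is reversed. *)
have [|||t ht <-] := @walk_onto (fun t => w (- t)) (- s) (- u) c.
- by lia.
- move=> t _; rewrite distrC; have := st (- t - 1); rewrite subrK.
  have -> : - (t + 1) = - t - 1 by lia.
  by [].
- by rewrite !opprK.
by exists (- t) => //; lia.
Qed.

Lemma int_antiderivative (s : int -> int) x0 :
  exists2 S : int -> int, S 0 = x0 & forall t, S (t + 1) = S t + s t.
Proof.
exists (fun t => match t with
  | Posz n => x0 + \sum_(i < n) s i%:Z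
  | Negz n => x0 - \sum_(i < n.+1) s (-1 - i%:Z) end).
  by change (x0 + \sum_(i < 0) s i%:Z = x0); rewrite big_ord0 addr0.
case=> n.
  have -> : n%:Z + 1 = n.+1%:Z by lia.
  by rewrite big_ord_recr/= addrA.
have -> : Negz n + 1 = - n%:Z by rewrite NegzE; lia.
have E : Negz n = -1 - n%:Z by rewrite NegzE; lia.
rewrite big_ord_recr/= -E opprD addrA subrK.
case: n E => [|n] E; last by rewrite -NegzE.
change (x0 + \sum_(i < 0) s i%:Z = x0 - \sum_(i < 0) s (-1 - i%:Z)).
by rewrite !big_ord0 oppr0.
Qed.

Lemma periodic_mulz (S : Type) (f : int -> S) (L : int) :
  (forall t, f (t + L) = f t) -> forall k t, f (t + k * L) = f t.
Proof.
move=> per [] n t.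
  elim: n t => [|n IH] t; first by rewrite mul0r addr0.
  by rewrite (_ : t + n.+1%:Z * L = t + n%:Z * L + L) ?per//; lia.
rewrite NegzE; elim: n t => [|n IH] t.
  have -> : t + - 1%:Z * L = t - L by lia.
  by rewrite -[in RHS](subrK L t) per.
by rewrite -[RHS]IH -[LHS]per; congr f; lia.
Qed.

Lemma int_reduce L a t : 0 < L -> exists k, a <= t - k * L < a + L.
Proof.
move=> L0; exists ((t - a) %/ L)%Z.
have := divz_eq (t - a) L.
have := modz_ge0 (t - a) (d := L); have := ltz_pmod (t - a) (d := L).
by lia.
Qed.

Lemma quasi_periodic_mulz (f : int -> int) (L D : int) :
  (forall t, f (t + L) = f t + D) -> forall k t, f (t + k * L) = f t + k * D.
Proof.
move=> per k t.
have {}per u : f (u + L) - f u = D by rewrite per; lia.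
case: k => n.
  elim: n => [|n IH]; first by rewrite !mul0r !addr0.
  have -> : t + n.+1%:Z * L = t + n%:Z * L + L by lia.
  by have := per (t + n%:Z * L); rewrite IH; lia.
rewrite NegzE; elim: n => [|n IH].
  have := per (t + - 1%:Z * L).
  have -> : t + - 1%:Z * L + L = t by lia.
  by move: (f _) (f _) => x y; lia.
have := per (t + - n.+2%:Z * L).
have -> : t + - n.+2%:Z * L + L = t + - n.+1%:Z * L by lia.
rewrite IH => h; apply: (addrI (- f (t + - n.+2%:Z * L))).
rewrite addNr; move: h; set x := f _; set y := f _ => h.
have -> : - n.+2%:Z * D = - n.+1%:Z * D - D by lia.
lia.
Qed.

End IntWalks.

(** * Periodic covers traced by subcontinua *)

Section Stages.
Variables (R : realType) (X : metricType R).
Implicit Types (A B : set X) (W V F G U : int -> set X) (e r : R).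
Local Notation d := (@mdist R X).

Definition seg W (p q : int) : set X := [set x | exists2 i, p <= i <= q & W i x].

Lemma seg_open W p q : (forall i, p <= i <= q -> open (W i)) -> open (seg W p q).
Proof.
move=> oW; apply/open_mdistP => x [i hi Wx].
have [r r0 rW] := (open_mdistP _).1 (oW i hi) x Wx.
by exists r => // y /rW; exists i.
Qed.

Lemma seg_closed W p q : (forall i, p <= i <= q -> closed (W i)) -> closed (seg W p q).
Proof.
move=> clW; have [pq|qp] := leP p q; last first.
  have -> : seg W p q = set0; last exact: closed0.
  by rewrite -subset0 => x [i]; lia.
have -> : seg W p q = \bigcup_(i in `I_(`|q - p|.+1)) W (p + i%:Z).
  apply/seteqP; split=> x.
    move=> [i hi Wx]; exists `|i - p|%N => /=; first by lia.
    by have -> : p + `|i - p|%N%:Z = i by lia.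
  by move=> [i /= hi Wx]; exists (p + i%:Z) => //; lia.
by apply: closed_bigcup => [|i /= hi]; [exact: finite_II|apply: clW; lia].
Qed.

(** If [A] missed [W k], the links before [k] and those after it would be two disjoint open sets
    separating [A]. *)
Lemma connected_meets_between A W lo hi i k j : connected A ->
  A `<=` seg W lo hi -> (forall l, lo <= l <= hi -> open (W l)) ->
  (forall l m, lo <= l < k -> k < m <= hi -> W l `&` W m = set0) ->
  lo <= i < k -> k < j <= hi -> A `&` W i !=set0 -> A `&` W j !=set0 ->
  A `&` W k !=set0.
Proof.
move=> cA AW oW dW hi' hj [x [Ax Wx]] [y [Ay Wy]]; apply: contrapT => nk.
have disj z l m : lo <= l < k -> k < m <= hi -> W l z -> W m z -> False.
  by move=> hl hm Wl Wm; have := dW _ _ hl hm; rewrite -subset0; apply; split; [exact: Wl|].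
have [|||||h|h] := @connected_split_open _ A (seg W lo (k - 1)) (seg W (k + 1) hi).
- exact: cA.
- by apply: seg_open => l hl; apply: oW; lia.
- by apply: seg_open => l hl; apply: oW; lia.
- move=> z Az; have [l hl Wl] := AW _ Az.
  have [lk|kl|lk] := ltgtP l k.
  + by left; exists l => //; lia.
  + by right; exists l => //; lia.
  + by exfalso; apply: nk; exists z; split=> //; rewrite -lk.
- rewrite -subset0 => z [_ [[l hl Wl] [m hm Wm]]].
  by apply: (disj z l m) => //; lia.
- have [l hl Wl] := h _ Ay; apply: (disj y l j) => //; lia.
- have [l hl Wl] := h _ Ax; apply: (disj x i l) => //; lia.
Qed.

Definition traced W := forall p q, p <= q -> exists A,
  [/\ subcontinuum A, A `<=` seg W p q &
   forall i, p <= i <= q -> A `&` W i !=set0].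

(** Since covers are periodic, the indices of all links meeting [A] need not form an interval; what
    is asked for is one interval around [[p, q]] whose links all meet [A] and together contain
    it. *)
Definition extendable W := forall A p q, connected A -> p <= q ->
  (forall i, p <= i <= q -> A `&` W i !=set0) ->
  exists p' q', [/\ p' <= p, q <= q', A `<=` seg W p' q' &
    forall i, p' <= i <= q' -> A `&` W i !=set0].

(** The common interface of the linear and the circular case: the ray is built from these fields
    alone, together with the refinements between levels. *)
Record stage e W (P : int) : Prop := Stage {
  stage_period_gt0 : 0 < P;
  stage_periodic : forall t, W (t + P) = W t;
  stage_nonempty : forall t, W t !=set0;
  stage_mesh : forall t x y, W t x -> W t y -> d x y < e;
  stage_consecutive : forall t, W t `&` W (t + 1) !=set0;
  stage_cover : forall x, exists t, W t x;
  stage_traced : traced W;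
  stage_extendable : extendable W }.

Lemma stage_cover_period e W P a x : stage e W P ->
  exists2 t, a <= t < a + P & W t x.
Proof.
move=> st; have [t Wt] := stage_cover st x.
have [k hk] := int_reduce a t (stage_period_gt0 st).
exists (t - k * P) => //.
by rewrite -mulNr (periodic_mulz (stage_periodic st)).
Qed.

Lemma stage_le e e' W P : e <= e' -> stage e W P -> stage e' W P.
Proof.
move=> ee' [P0 per ne mesh cons cov tr ext]; split=> // t x y Wx Wy.
exact: lt_le_trans (mesh t x y Wx Wy) ee'.
Qed.

Lemma seg_shift W s p q : seg (fun t => W (t + s)) p q = seg W (p + s) (q + s).
Proof.
apply/seteqP; split=> x [i hi Wx]; first by exists (i + s) => //; lia.
by exists (i - s); [lia|rewrite subrK].
Qed.

Lemma stage_shift e W P s : stage e W P -> stage e (fun t => W (t + s)) P.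
Proof.
move=> st; split.
- exact: stage_period_gt0 st.
- by move=> t; rewrite addrAC (stage_periodic st).
- by move=> t; exact: stage_nonempty st _.
- by move=> t; exact: (stage_mesh st).
- by move=> t; have := stage_consecutive st (t + s); rewrite addrAC.
- by move=> x; have [t Wt] := stage_cover st x; exists (t - s); rewrite subrK.
- move=> p q pq; have [|A [cA AW Am]] := stage_traced st (p := p + s) (q := q + s); first by lia.
  by exists A; rewrite seg_shift; split=> // i hi; apply: Am; lia.
- move=> A p q cA pq Am.
  have [||p' [q' [h1 h2 h3 h4]]] := stage_extendable st (A := A) (p := p + s) (q := q + s) cA.
  + by lia.
  + by move=> i hi; have := Am (i - s); rewrite subrK; apply; lia.
  exists (p' - s), (q' - s); split; [lia|lia|by rewrite seg_shift !subrK|].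
  by move=> i hi; apply: h4; lia.
Qed.

Lemma seg_opp W p q : seg (fun t => W (- t)) p q = seg W (- q) (- p).
Proof.
apply/seteqP; split=> x [i hi Wx]; first by exists (- i) => //; lia.
by exists (- i); [lia|rewrite opprK].
Qed.

Lemma stage_opp e W P : stage e W P -> stage e (fun t => W (- t)) P.
Proof.
move=> st; split.
- exact: stage_period_gt0 st.
- by move=> t; rewrite -(stage_periodic st (- (t + P))); congr W; lia.
- by move=> t; exact: stage_nonempty st _.
- by move=> t; exact: (stage_mesh st).
- move=> t; have := stage_consecutive st (- (t + 1)); rewrite setIC.
  by have -> : - (t + 1) + 1 = - t by lia.
- by move=> x; have [t Wt] := stage_cover st x; exists (- t); rewrite opprK.
- move=> p q pq; have [|A [cA AW Am]] := stage_traced st (p := - q) (q := - p); first by lia.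
  by exists A; rewrite seg_opp; split=> // i hi; apply: Am; lia.
- move=> A p q cA pq Am.
  have [||p' [q' [h1 h2 h3 h4]]] := stage_extendable st (A := A) (p := - q) (q := - p) cA.
  + by lia.
  + by move=> i hi; have := Am (- i); rewrite opprK; apply; lia.
  exists (- q'), (- p'); split; [lia|lia|by rewrite seg_opp !opprK|].
  by move=> i hi; apply: h4; lia.
Qed.

(** The change of level takes place at time [tau], when the fine and the coarse index agree. The
    coarse links from [tau] to [tau + H] already cover the space, and at time [T] the projected walk
    has climbed through all of them. *)
Record refines_at W W' (Phi : int -> int) (tau H T : int) : Prop := RefinesAt {
  refines_sub : forall t, tau <= t -> W' t `<=` W (Phi t);
  refines_step : forall t, tau <= t -> `|Phi (t + 1) - Phi t| <= 1;
  refines_ge : forall t, tau <= t -> tau <= Phi t;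
  refines_start : Phi tau = tau;
  refines_time : tau <= T;
  refines_reach : Phi T = tau + H;
  refines_height : 0 <= H;
  refines_full : forall x, exists2 t, tau <= t <= tau + H & W t x }.

(* Starting at a minimum of [Phi] over one period keeps [Phi] above its
   initial value forever, because the drift [D] is nonnegative. *)
Lemma refines_at_shift e e' W W' P P' Phi D tau0 :
  stage e W P -> stage e' W' P' ->
  (forall t, `|Phi (t + 1) - Phi t| <= 1) -> (forall t, W' t `<=` W (Phi t)) ->
  (forall t, Phi (t + P') = Phi t + D) -> 0 <= D ->
  exists s Phi' tau H T, tau0 <= tau /\
    refines_at W (fun t => W' (t + s)) Phi' tau H T.
Proof.
move=> st st' lip sub per D0.
have P0 := stage_period_gt0 st; have P'0 := stage_period_gt0 st'.
have [|t0 ht0 min0] := @walk_min Phi 0 (P' - 1); first by lia.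
have ge0 t : t0 <= t -> Phi t0 <= Phi t.
  move=> t0t; have [k hk] := int_reduce 0 t P'0.
  have -> : t = t - k * P' + k * P' by lia.
  rewrite (quasi_periodic_mulz per).
  have := min0 (t - k * P').
  have k0 : 0 <= k by nia.
  have := mulr_ge0 k0 D0.
  by lia.
(* One period of fine links covers the space and projects between [Phi t0] and [Phi t1], which
   yields [H] and [T]. *)
have [|t1 ht1 max1] := @walk_max Phi t0 (t0 + P' - 1); first by lia.
have [k hk] := int_reduce tau0 (Phi t0) P0.
set tau := Phi t0 - k * P in hk.
(* Time [t0] is moved to [tau]; the values of [Phi] are moved by a multiple of [P], which leaves the
   coarse links unchanged. *)
exists (t0 - tau), (fun t => Phi (t + (t0 - tau)) + (tau - Phi t0)), tau,
  (Phi t1 - Phi t0), (t1 - t0 + tau).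
have WE u : W (u + (tau - Phi t0)) = W u.
  have -> : tau - Phi t0 = (- k) * P by rewrite /tau; lia.
  by rewrite (periodic_mulz (stage_periodic st)).
split; first by lia.
split.
- by move=> t ht x W'x; rewrite WE; exact: sub.
- move=> t ht; have := lip (t + (t0 - tau)).
  have -> : t + 1 + (t0 - tau) = t + (t0 - tau) + 1 by lia.
  by move: (Phi _) (Phi (t + _)) => a b; lia.
- by move=> t ht; have := ge0 (t + (t0 - tau)); lia.
- have -> : tau + (t0 - tau) = t0 by lia.
  by lia.
- by lia.
- have -> : t1 - t0 + tau + (t0 - tau) = t1 by lia.
  by lia.
- by have := ge0 t1; lia.
- move=> x; have [t ht W't] := stage_cover_period t0 x st'.
  exists (Phi t + (tau - Phi t0)); last by rewrite WE; exact: sub.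
  by have := ge0 t; have := max1 t; lia.
Qed.

End Stages.

(** * Linear chains *)

Section LinearChains.
Variables (R : realType) (X : metricType R).
Hypothesis cX : compact [set: X].
Hypothesis conX : connected [set: X].
Hypothesis X0 : [set: X] !=set0.
Implicit Types (A B : set X) (W V F G U : int -> set X) (e r : R) (N : int).
Local Notation d := (@mdist R X).

(** Links are allowed to be empty and neighbours need not meet; both defects are repaired later from
    the connectedness of [X]. *)
Record lchain e N G : Prop := LChain {
  lchain_ge0 : 0 <= N;
  lchain_closed : forall i, 0 <= i <= N -> closed (G i);
  lchain_disjoint : forall i j, 0 <= i -> j <= N -> i + 1 < j -> G i `&` G j = set0;
  lchain_cover : forall x, exists2 i, 0 <= i <= N & G i x;
  lchain_mesh : forall i x y, 0 <= i <= N -> G i x -> G i y -> d x y < e }.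

Lemma lchain_interval e G lo hi : lo <= hi ->
  (forall i, lo <= i <= hi -> closed (G i)) ->
  (forall i j, lo <= i -> j <= hi -> i + 1 < j -> G i `&` G j = set0) ->
  (forall x, exists2 i, lo <= i <= hi & G i x) ->
  (forall i x y, lo <= i <= hi -> G i x -> G i y -> d x y < e) ->
  lchain e (hi - lo) (fun i => G (i + lo)).
Proof.
move=> lohi clG dG cG mG; split; first by lia.
- by move=> i hi'; apply: clG; lia.
- by move=> i j h1 h2 h3; apply: dG; lia.
- by move=> x; have [i hi' Gi] := cG x; exists (i - lo); [lia|rewrite subrK].
- by move=> i x y hi'; apply: mG; lia.
Qed.

Lemma setT_split_closed (C D : set X) : closed C -> closed D ->
  (forall x, C x \/ D x) -> C `&` D = set0 -> (forall x, C x) \/ (forall x, D x).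
Proof.
move=> clC clD CD CD0; have [||h|h] := connected_split_closed conX clC clD.
- by move=> x _; exact: CD.
- by rewrite setTI.
- by left=> x; exact: h.
- by right=> x; exact: h.
Qed.

(** An empty link splits the rest into two disjoint closed sets; by connectedness one of them is all
    of [X], and the chain becomes shorter. *)
Lemma lchain_minimal e N G : lchain e N G -> exists N' G', lchain e N' G' /\
  forall i, 0 <= i <= N' -> G' i !=set0.
Proof.
have [n nE] : exists n, (`|N| <= n)%N by exists `|N|%N.
elim: n N G nE => [|n IH] N G nN ch.
  exists N, G; split=> // i hi.
  have [x _] := X0; have [j hj Gj] := lchain_cover ch x.
  exists x; have -> : i = j by have := lchain_ge0 ch; lia.
  by [].
have [h|] := pselect (forall i, 0 <= i <= N -> G i !=set0); first by exists N, G.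
move=> /existsNP[i /not_implyP[hi nGi]].
have notGi x : ~ G i x by move=> Gi; apply: nGi; exists x.
have clG lo hi' : 0 <= lo -> hi' <= N -> closed (seg G lo hi').
  by move=> h1 h2; apply: seg_closed => j hj; apply: (lchain_closed ch); lia.
have [||||h|h] := @setT_split_closed (seg G 0 (i - 1)) (seg G (i + 1) N).
- by apply: clG; lia.
- by apply: clG; lia.
- move=> x; have [j hj Gj] := lchain_cover ch x.
  have [ji|ij|ji] := ltgtP j i.
  + by left; exists j => //; lia.
  + by right; exists j => //; lia.
  + by case: (notGi x); rewrite -ji.
- rewrite -subset0 => x [[j hj Gj] [k hk Gk]].
  by rewrite -(@lchain_disjoint _ _ _ ch j k); [split| lia|lia|lia].
- have [x _] := X0; have [j hj _] := h x.
  apply: (IH (i - 1) G); first by lia.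
  split; first by lia.
  + by move=> k hk; apply: (lchain_closed ch); lia.
  + by move=> k l h1 h2 h3; apply: (lchain_disjoint ch); lia.
  + by move=> y; have [k hk Gk] := h y; exists k.
  + by move=> k y z hk; apply: (lchain_mesh ch); lia.
- have [x _] := X0; have [j hj _] := h x.
  apply: (IH (N - (i + 1)) (fun k => G (k + (i + 1)))); first by lia.
  apply: lchain_interval; first by lia.
  + by move=> k hk; apply: (lchain_closed ch); lia.
  + by move=> k l h1 h2 h3; apply: (lchain_disjoint ch); lia.
  + by move=> y; have [k hk Gk] := h y; exists k.
  + by move=> k y z hk; apply: (lchain_mesh ch); lia.
Qed.

(** The closed cores [G] serve in separation arguments and in the cut-wire theorem, the open links
    [V] for the Lebesgue number and for the overlaps of neighbours. *)
Record tchain e N G V : Prop := TChain {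
  tchain_ge0 : 0 <= N;
  tchain_closed : forall i, 0 <= i <= N -> closed (G i);
  tchain_nonempty : forall i, 0 <= i <= N -> G i !=set0;
  tchain_cover : forall x, exists2 i, 0 <= i <= N & G i x;
  tchain_open : forall i, 0 <= i <= N -> open (V i);
  tchain_sub : forall i, 0 <= i <= N -> G i `<=` V i;
  tchain_disjoint : forall i j, 0 <= i -> j <= N -> i + 1 < j -> V i `&` V j = set0;
  tchain_lebesgue : exists2 r, 0 < r &
    forall x, exists2 i, 0 <= i <= N & forall y, d x y < r -> V i y;
  tchain_mesh : forall i x y, 0 <= i <= N -> V i x -> V i y -> d x y < e }.

Lemma lchain_thicken e N G : 0 < e -> lchain e N G ->
  (forall i, 0 <= i <= N -> G i !=set0) -> exists V, tchain (2 * e) N G V.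
Proof.
move=> e0 ch nG; have N0 := lchain_ge0 ch.
have [|r r0 rG] := @thicken_finite R X 'I_(`|N|.+1) (fun i => G (i : nat)%:Z) cX.
  by move=> i; apply: (lchain_closed ch); have := ltn_ord i; lia.
(* The bound [r] keeps distant links disjoint, and [e / 2] keeps the mesh below [2 * e]. *)
pose s := Order.min r (e / 2).
have s0 : 0 < s by rewrite lt_min r0; lra.
have sr : s <= r by rewrite ge_min lexx.
have se : s <= e / 2 by rewrite ge_min lexx orbT.
exists (fun i => [set x | exists2 g, G i g & d g x < s]); split => //.
- exact: lchain_closed ch.
- exact: lchain_cover ch.
- move=> i hi; apply/open_mdistP => x [g Gg gx].
  exists (s - d g x); first by rewrite subr_gt0.
  by move=> y xy; exists g => //; have := metric_triangle g x y; lra.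
- by move=> i hi x Gx; exists x => //; rewrite mdistxx.
- move=> i j i0 jN ij; rewrite -subset0 => x [[g Gg gx] [h Gh hx]].
  have li : (`|i| < `|N|.+1)%N by lia.
  have lj : (`|j| < `|N|.+1)%N by lia.
  have := rG (Ordinal li) (Ordinal lj) g h x.
  have -> : (Ordinal li : nat)%:Z = i by rewrite /=; lia.
  have -> : (Ordinal lj : nat)%:Z = j by rewrite /=; lia.
  move=> /(_ Gg Gh (lt_le_trans gx sr) (lt_le_trans hx sr))[z [Gz Hz]].
  have : (G i `&` G j) z by [].
  by rewrite (lchain_disjoint ch).
- exists s => // x; have [i hi Gi] := lchain_cover ch x.
  by exists i => // y xy; exists x.
- move=> i x y hi [g Gg gx] [h Gh hy].
  have := lchain_mesh ch hi Gg Gh; have := metric_triangle x g y.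
  by have := metric_triangle g h y; rewrite (metric_sym x g); lra.
Qed.

Section OneChain.
Variables (e : R) (N : int) (G V : int -> set X).
Hypothesis ch : tchain e N G V.

Let N0 : 0 <= N. Proof. exact: tchain_ge0 ch. Qed.

Lemma tchain_disjointG i j : 0 <= i -> j <= N -> i + 1 < j -> G i `&` G j = set0.
Proof.
move=> i0 jN ij; rewrite -subset0 => x [Gi Gj].
rewrite -(tchain_disjoint ch i0 jN ij).
by split; apply: (tchain_sub ch) => //; lia.
Qed.

(** Otherwise the cores up to [i] and the cores after [i] would separate [X]. *)
Lemma tchain_consecutive i : 0 <= i < N -> V i `&` V (i + 1) !=set0.
Proof.
move=> hi; apply: contrapT => h.
have clG lo hi' : 0 <= lo -> hi' <= N -> closed (seg G lo hi').
  by move=> h1 h2; apply: seg_closed => j hj; apply: (tchain_closed ch); lia.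
have [||||h'|h'] := @setT_split_closed (seg G 0 i) (seg G (i + 1) N).
- by apply: clG; lia.
- by apply: clG; lia.
- move=> x; have [j hj Gj] := tchain_cover ch x.
  have [ji|ij] := leP j i; [left|right]; exists j => //; lia.
- rewrite -subset0 => x [[j hj Gj] [k hk Gk]].
  have [jk|jk] := ltP (j + 1) k.
    by rewrite -(@tchain_disjointG j k); [split|lia|lia|lia].
  apply: h; exists x; split; apply: (tchain_sub ch); [lia| |lia|].
    by have -> : i = j by lia.
  by have -> : i + 1 = k by lia.
- have [|x Gx] := @tchain_nonempty _ _ _ _ ch N; first by lia.
  have [j hj Gj] := h' x; have [jN|jN] := ltP (j + 1) N.
    have : (G j `&` G N) x by [].
    by rewrite tchain_disjointG; [|lia|lia|lia].
  apply: h; exists x; split; apply: (tchain_sub ch); [lia| |lia|].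
    by have -> : i = j by lia.
  by have -> : i + 1 = N by lia.
- have [|x Gx] := @tchain_nonempty _ _ _ _ ch 0; first by lia.
  have [j hj Gj] := h' x; have [jN|jN] := ltP (0 + 1) j.
    have : (G 0 `&` G j) x by [].
    by rewrite tchain_disjointG; [|lia|lia|lia].
  apply: h; exists x; split; apply: (tchain_sub ch); [lia| |lia|].
    by have -> : i = 0 by lia.
  by have -> : i + 1 = j by lia.
Qed.

(** By the cut-wire theorem, failure gives a clopen part of the arc containing [G a] and missing
    [G b]. Adding the links before [a] to it, and those after [b] to its complement, would separate
    [X]. *)
Lemma tchain_traced a b : 0 <= a -> a <= b -> b <= N -> exists A,
  [/\ subcontinuum A, A `<=` seg V a b &
   forall i, a <= i <= b -> A `&` V i !=set0].
Proof.
move=> a0 ab bN.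
have GV p q : 0 <= p -> q <= N -> seg G p q `<=` seg V p q.
  by move=> p0 qN x [i hi Gi]; exists i => //; apply: (tchain_sub ch) => //; lia.
have [abE|anb] := eqVneq a b.
  have [|x Gx] := @tchain_nonempty _ _ _ _ ch a; first by lia.
  exists [set x]; split.
  - by split; [exists x|exact: compact_set1|exact: connected1].
  - by move=> _ ->; apply: GV => //; exists a => //; lia.
  - move=> i hi; exists x; split=> //; have -> : i = a by lia.
    by apply: (tchain_sub ch) => //; lia.
have clG lo hi' : 0 <= lo -> hi' <= N -> closed (seg G lo hi').
  by move=> h1 h2; apply: seg_closed => j hj; apply: (tchain_closed ch); lia.
have [|||||[A [cA clA AK Aa Ab]]|[C [[CK clC clKC] aC Cb]]] :=
    @connected_or_clopen R X cX (seg G a b) (G a) (G b).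
- by apply: clG; lia.
- by apply: (tchain_closed ch); lia.
- by apply: (tchain_closed ch); lia.
- by move=> x Gx; exists a => //; lia.
- by move=> x Gx; exists b => //; lia.
- have [x [Ax Gx]] := Aa; have [y [Ay Gy]] := Ab.
  exists A; split.
  + split=> //; first by exists x.
    by apply: (subclosed_compact clA cX).
  + by apply: (subset_trans AK); apply: GV.
  + have Va : A `&` V a !=set0 by exists x; split=> //; apply: (tchain_sub ch) => //; lia.
    have Vb : A `&` V b !=set0 by exists y; split=> //; apply: (tchain_sub ch) => //; lia.
    move=> i hi; have [->//|ia] := eqVneq i a; have [->//|ib] := eqVneq i b.
    apply: (@connected_meets_between R X A V a b a i b) => //; try lia.
    * by apply: (subset_trans AK); apply: GV.
    * by move=> l hl; apply: (tchain_open ch); lia.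
    * by move=> l m hl hm; apply: (tchain_disjoint ch); lia.
- exfalso.
  have [||||h|h] := @setT_split_closed (seg G 0 (a - 1) `|` C)
      ((seg G a b `\` C) `|` seg G (b + 1) N).
  + by apply: closedU => //; apply: clG; lia.
  + by apply: closedU => //; apply: clG; lia.
  + move=> x; have [j hj Gj] := tchain_cover ch x.
    have [ja|aj] := ltP j a; first by left; left; exists j => //; lia.
    have [bj|jb] := ltP b j; first by right; right; exists j => //; lia.
    have [Cx|nCx] := pselect (C x); first by left; right.
    by right; left; split=> //; exists j => //; lia.
  + rewrite -subset0 => x [[[j hj Gj]|Cx] [[[k hk Gk] nCx]|[k hk Gk]]] //.
    * have [ka|ka] := eqVneq k a; first by apply: nCx; apply: aC; rewrite -ka.
      by rewrite -(@tchain_disjointG j k); [split|lia|lia|lia].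
    * by rewrite -(@tchain_disjointG j k); [split|lia|lia|lia].
    * have [j hj Gj] := CK _ Cx.
      have [jb|jb] := eqVneq j b; first by rewrite -Cb; split=> //; rewrite -jb.
      by rewrite -(@tchain_disjointG j k); [split|lia|lia|lia].
  + have [|x Gx] := @tchain_nonempty _ _ _ _ ch b; first by lia.
    have [[j hj Gj]|Cx] := h x.
      have : (G j `&` G b) x by [].
      by rewrite tchain_disjointG; [|lia|lia|lia].
    by have : (C `&` G b) x by []; rewrite Cb.
  + have [|x Gx] := @tchain_nonempty _ _ _ _ ch a; first by lia.
    have [[_ []]|[j hj Gj]] := h x; first exact: aC.
    have : (G a `&` G j) x by [].
    by rewrite tchain_disjointG; [|lia|lia|lia].
Qed.

(** Times and links are exchanged in both directions: [walk_range] turns an interval of times into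
    an interval of links to be traced, and [zig_extend] turns the interval of links met by a
    connected set back into an interval of times. *)
Lemma tchain_stage : stage e (fun t => V (zig N t)) (2 * N + 2).
Proof.
have zr t : 0 <= zig N t <= N by exact: zig_range.
have zs t : `|zig N (t + 1) - zig N t| <= 1 by exact: zig_step.
have VV i j : 0 <= i <= N -> 0 <= j <= N -> `|j - i| <= 1 -> V i `&` V j !=set0.
  move=> hi hj hij; have [ij|ji|<-] := ltgtP i j.
  - have -> : j = i + 1 by lia.
    by apply: tchain_consecutive; lia.
  - rewrite setIC; have -> : i = j + 1 by lia.
    by apply: tchain_consecutive; lia.
  - have [x Gx] := tchain_nonempty ch hi.
    by exists x; split; apply: (tchain_sub ch).
split.
- by lia.
- by move=> t; rewrite zig_periodic.
- by move=> t; have [x Gx] := tchain_nonempty ch (zr t); exists x; apply: (tchain_sub ch).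
- by move=> t x y; apply: (tchain_mesh ch).
- by move=> t; apply: VV.
- move=> x; have [i hi Gi] := tchain_cover ch x; exists i.
  have := @zig_at N 0 i N0; rewrite mul0r add0r => ->; last by lia.
  by case: ifP; [lia|move=> _]; case: ifP; [move=> _|lia]; apply: (tchain_sub ch).
- move=> p q pq; have [a [b [ab h1 h2]]] := walk_range pq zs.
  have [t ht ta] := h2 a ltac:(lia); have [u hu ub] := h2 b ltac:(lia).
  have [|||A [cA AV Am]] := @tchain_traced a b => //.
  + by rewrite -ta; have := zr t; lia.
  + by rewrite -ub; have := zr u; lia.
  exists A; split=> //.
  + by move=> x /AV[i hi Vi]; have [s hs si] := h2 i hi; exists s => //; rewrite si.
  + by move=> i hi; apply: Am; exact: h1.
- move=> A p q cA pq Am.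
  pose S i := A `&` V i !=set0.
  have Szp : S (zig N p) by apply: Am; lia.
  have := zr p; move=> /andP[zp0 zpN].
  have [a [ha Sa amin]] := int_min zp0 Szp.
  have [b [hb Sb bmax]] := int_max zpN Szp.
  have AT x : A x -> exists2 i, 0 <= i <= N & V i x.
    by move=> _; have [i hi Gi] := tchain_cover ch x; exists i => //; apply: (tchain_sub ch).
  have Sab i : 0 <= i <= N -> S i -> a <= i <= b.
    move=> hi Si; apply/andP; split; rewrite leNgt; apply/negP => h.
      by apply: (amin i) => //; lia.
    by apply: (bmax i) => //; lia.
  have Sall i : a <= i <= b -> S i.
    move=> hi; have [->//|ia] := eqVneq i a; have [->//|ib] := eqVneq i b.
    apply: (@connected_meets_between R X A V 0 N a i b) => //; try lia.
    + by move=> l hl; apply: (tchain_open ch); lia.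
    + by move=> l m hl hm; apply: (tchain_disjoint ch); lia.
  have [||||p' [q' [h1 h2 h3 h4]]] := @zig_extend N a b p q => //; try lia.
    by move=> t ht; apply: Sab => //; exact: Am.
  exists p', q'; split=> //.
  + move=> x Ax; have [i hi Vi] := AT x Ax.
    have [|t ht ti] := h4 i; first by apply: Sab => //; exists x.
    by exists t => //; rewrite ti.
  + by move=> i hi; apply: Sall; exact: h3.
Qed.

End OneChain.

(* Adjacency is tested on a window only: the folded cover repeats every link,
   so distant indices may carry the same set. *)
Definition linear_window W := exists c N, [/\ 0 <= N,
  exists2 r, 0 < r & forall x, exists2 t, c <= t <= c + N & forall y, d x y < r -> W t y &
  forall s t, c <= s <= c + N -> c <= t <= c + N -> W s `&` W t !=set0 -> `|s - t| <= 1].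

Lemma tchain_window e N G V : tchain e N G V -> linear_window (fun t => V (zig N t)).
Proof.
move=> ch; have N0 := tchain_ge0 ch; exists 0, N.
have zE i : 0 <= i <= N -> zig N i = i.
  move=> hi; have := @zig_at N 0 i N0; rewrite mul0r add0r => ->; last by lia.
  by repeat case: ifP; lia.
split=> //.
  have [r r0 h] := tchain_lebesgue ch; exists r => // x.
  by have [i hi Vi] := h x; exists i; rewrite ?zE ?add0r.
move=> s t hs ht; rewrite !zE//; try lia.
move=> [x [Vs Vt]]; have [st|ts|->] := ltgtP s t; last by lia.
- have [h|h] := ltP (s + 1) t; last by lia.
  have : (V s `&` V t) x by [].
  by rewrite (tchain_disjoint ch); [|lia|lia|lia].
- have [h|h] := ltP (t + 1) s; last by lia.
  have : (V t `&` V s) x by [].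
  by rewrite (tchain_disjoint ch); [|lia|lia|lia].
Qed.

Lemma window_shift W s : linear_window W -> linear_window (fun t => W (t + s)).
Proof.
move=> [c [N [N0 [r r0 h1] h2]]]; exists (c - s), N; split=> //.
  exists r => // x; have [t ht Wt] := h1 x; exists (t - s); first by lia.
  by move=> y /Wt; rewrite subrK.
move=> u t hu ht /h2 h; have := h _ _; lia.
Qed.

Hypothesis chainable : forall e, 0 < e -> exists N G, lchain e N G.

Lemma chainable_tchain e : 0 < e -> exists N G V, tchain e N G V.
Proof.
move=> e0; have e20 : 0 < e / 2 by lra.
have [N [G ch]] := chainable e20.
have [N' [G' [ch' nG']]] := lchain_minimal ch.
have [V tV] := lchain_thicken e20 ch' nG'.
by exists N', G', V; have -> : e = 2 * (e / 2) by lra.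
Qed.

Lemma linear_stage e : 0 < e -> exists W P, stage e W P /\ linear_window W.
Proof.
move=> /chainable_tchain[N [G [V tV]]].
exists (fun t => V (zig N t)), (2 * N + 2).
by split; [exact: tchain_stage tV|exact: tchain_window tV].
Qed.

(** All coarse links are chosen in one window, where overlapping links have neighbouring indices.
    The projection is therefore a unit-step walk that repeats exactly, with drift 0. *)
Lemma linear_refine e W P e' tau0 : stage e W P -> linear_window W -> 0 < e' ->
  exists W' P' Phi tau H T,
    [/\ stage e' W' P', linear_window W', tau0 <= tau & refines_at W W' Phi tau H T].
Proof.
move=> st [c [N [N0 [r r0 lebW] adjW]]] e'0.
pose e1 := Order.min e' r.
have e10 : 0 < e1 by rewrite lt_min e'0.
have [N' [G' [V' tV']]] := chainable_tchain e10.
have N'0 := tchain_ge0 tV'.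
have zr t : 0 <= zig N' t <= N' by exact: zig_range.
have /choice[f fP] i : exists t, 0 <= i <= N' -> (c <= t <= c + N /\ V' i `<=` W t).
  have [hi|hi] := pselect (0 <= i <= N'); last by exists 0.
  have [x Gx] := tchain_nonempty tV' hi; have [t ht Wt] := lebW x.
  exists t => _; split=> // y V'y; apply: Wt.
  have := tchain_mesh tV' hi (tchain_sub tV' hi Gx) V'y.
  by move=> /lt_le_trans; apply; rewrite ge_min lexx orbT.
have stg : stage e' (fun t => V' (zig N' t)) (2 * N' + 2).
  by apply: stage_le (tchain_stage tV'); rewrite ge_min lexx.
have [||||s [Phi [tau [H [T [h1 h2]]]]]] :=
    @refines_at_shift R X e e' W _ P _ (fun t => f (zig N' t)) 0 tau0 st stg.
- move=> t; have [hf1 sf1] := fP _ (zr (t + 1)); have [hf sf] := fP _ (zr t).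
  apply: adjW => //; have [x [x1 x2]] := stage_consecutive stg t.
  by exists x; split; [exact: sf1|exact: sf].
- by move=> t; have [_] := fP _ (zr t).
- by move=> t; rewrite zig_periodic addr0.
- by [].
exists (fun t => V' (zig N' (t + s))), (2 * N' + 2), Phi, tau, H, T; split=> //.
  exact: (stage_shift s stg).
exact: (window_shift s (tchain_window tV')).
Qed.

End LinearChains.

(** * Circular chains *)

Section CircularChains.
Variables (R : realType) (X : metricType R).
Hypothesis cX : compact [set: X].
Hypothesis conX : connected [set: X].
Implicit Types (A B : set X) (W V F G U : int -> set X) (e r : R) (L : int).
Local Notation d := (@mdist R X).

Definition circular_adjacency W L := forall s t,
  W s `&` W t !=set0 -> exists m : int, `|t - s + m * L| <= 1.

(* The closed sets [F] shrink the open links [U] of a circular chain with [L]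
   links, all indexed periodically by the integers. *)
Record cchain e L F U : Prop := CChain {
  cchain_length : 4 <= L;
  cchain_periodicF : forall t, F (t + L) = F t;
  cchain_periodic : forall t, U (t + L) = U t;
  cchain_closed : forall t, closed (F t);
  cchain_cover : forall x, exists t, F t x;
  cchain_open : forall t, open (U t);
  cchain_sub : forall t, F t `<=` U t;
  cchain_adjacency : circular_adjacency U L;
  cchain_consecutive : forall t, U t `&` U (t + 1) !=set0;
  cchain_lebesgue : exists2 r, 0 < r & forall x, exists t, forall y, d x y < r -> U t y;
  cchain_mesh : forall t x y, U t x -> U t y -> d x y < e }.

Lemma circular_chain_cchain e (n : nat) (U : 'I_n.+1 -> set X) :
  eps_circular_chain e U -> \bigcup_i U i = [set: X] ->
  (exists x y, 2 * e <= d x y) -> exists L F V, cchain e L F V.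
Proof.
move=> [[nU adjU] mU] covU [x0 [y0 xy0]].
have oU i : open (U i) by have [_] := nU i.
have cov x : exists i, U i x.
  have : [set: X] x by [].
  by rewrite -covU => -[i _ Ui]; exists i.
have mesh i x y : U i x -> U i y -> d x y < e.
  move=> Ux Uy; have := mU i; rewrite -lte_fin; apply: le_lt_trans.
  by apply: ereal_sup_ubound; exists (x, y).
(* Any two of at most three links would meet, which would bound all distances strictly by
   [2 * e]. *)
have n3 : (3 <= n)%N.
  rewrite leqNgt; apply/negP => n2; have [i Ui] := cov x0; have [j Uj] := cov y0.
  have : U i `&` U j !=set0.
    apply/adjU; have := ltn_ord i; have := ltn_ord j => jn in_.
    have [h|h] := pselect (`|(i : nat)%:Z - (j : nat)%:Z| <= 1); [by left|right].
    have [[i0 j0]|[i0 j0]] :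
        ((i : nat) = 0 /\ (j : nat) = n \/ (i : nat) = n /\ (j : nat) = 0)%N by lia.
      have -> : i = ord0 by apply: val_inj.
      by have -> : j = ord_max by apply: val_inj.
    rewrite setUC.
    have -> : j = ord0 by apply: val_inj.
    by have -> : i = ord_max by apply: val_inj.
  move=> [z [Uiz Ujz]]; have := mesh _ _ _ Ui Uiz; have := mesh _ _ _ Ujz Uj.
  by have := metric_triangle x0 z y0; lra.
have [r r0 rU] := lebesgue_number cX oU cov.
pose L : int := n.+1%:Z.
have L0 : 0 < L by [].
pose o (t : int) : 'I_n.+1 := inord `|(t %% L)%Z|%N.
have oE t : exists k, (o t : nat)%:Z = t - k * L.
  exists (t %/ L)%Z; have := divz_eq t L.
  have := modz_ge0 t (d := L); have := ltz_pmod t (d := L) => h1 h2.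
  have -> : (o t : nat) = `|(t %% L)%Z|%N by rewrite /o inordK//; lia.
  by lia.
have operi t : o (t + L) = o t by rewrite /o modzDr.
have on (i : 'I_n.+1) : o (i : nat)%:Z = i.
  apply: val_inj; rewrite /o modz_small/=; last by have := ltn_ord i; lia.
  by rewrite inordK.
(* The shrunken link consists of the points whose [r]-ball lies in the link; as [r] is a Lebesgue
   number, these closed sets still cover. *)
exists L, (fun t => [set x | forall y, d x y < r -> U (o t) y]), (fun t => U (o t)).
split.
- by rewrite /L; lia.
- by move=> t; rewrite operi.
- by move=> t; rewrite operi.
- move=> t; rewrite -openC; apply/open_mdistP => x /= /existsNP[y /not_implyP[xy nU']].
  exists (r - d x y); first by rewrite subr_gt0.
  move=> z xz /(_ y) h; apply: nU'; apply: h.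
  by have := metric_triangle z x y; rewrite (metric_sym z x); lra.
- by move=> x; have [i Ui] := rU x; exists (i : nat)%:Z; rewrite /= on.
- by move=> t; exact: oU.
- by move=> t x; apply; rewrite mdistxx.
- move=> s t /adjU; have [k sk] := oE s; have [l tl] := oE t.
  have := ltn_ord (o s); have := ltn_ord (o t) => lt_t lt_s.
  move=> [h|h].
    by exists (k - l); lia.
  have : [set o s; o t] (o s) by left.
  have : [set o s; o t] (o t) by right.
  rewrite h => ht hs.
  case: hs => /(congr1 (@nat_of_ord _)) /= hs; case: ht => /(congr1 (@nat_of_ord _)) /= ht.
  + by exists (k - l); lia.
  + by exists (k - l - 1); rewrite /L in sk tl *; lia.
  + by exists (k - l + 1); rewrite /L in sk tl *; lia.
  + by exists (k - l); lia.
- move=> t; apply/adjU.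
  have [k tk] := oE t; have [l tl] := oE (t + 1).
  have := ltn_ord (o t); have := ltn_ord (o (t + 1)) => lt_t1 lt_t.
  have [ot|ot] := eqVneq (o t : nat) n.
    right; have -> : o t = ord_max by apply: val_inj.
    have -> : o (t + 1) = ord0.
      apply: val_inj => /=; rewrite /L in tk tl.
      have : (l - k - 1) * n.+1%:Z = - (o (t + 1) : nat)%:Z by lia.
      have [->|lk] := eqVneq l (k + 1); first by lia.
      by nia.
    by rewrite setUC.
  left; rewrite /L in tk tl.
  have lk : l = k by nia.
  by rewrite lk in tl; lia.
- by exists r => // x; have [i Ui] := rU x; exists (i : nat)%:Z; rewrite on.
- by move=> t; exact: mesh.
Qed.

Section OneChain.
Variables (e : R) (L : int) (F U : int -> set X).
Hypothesis ch : cchain e L F U.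
Hypothesis not_chainable : forall N G, ~ lchain e N G.

Let L4 : 4 <= L. Proof. exact: cchain_length ch. Qed.

(** The gap is allowed to exceed one turn because the unrolled chain of [cchain_crossing] runs over
    more than one period. *)
Lemma cchain_adjacent_gap s t x : U s x -> U t x -> s < t -> t - s <= 2 * L - 2 ->
  t - s <= 1 \/ L - 1 <= t - s <= L + 1.
Proof.
move=> Us Ut st tsL.
have [|m hm] := @cchain_adjacency _ _ _ _ ch s t; first by exists x.
have [h1|[mE|h1]] : 0 <= m \/ m = -1 \/ m <= -2 by lia.
- have : 0 <= m * L by apply: mulr_ge0 => //; lia.
  by lia.
- by rewrite mE in hm; lia.
- have : 0 <= (-2 - m) * L by apply: mulr_ge0 => //; lia.
  by lia.
Qed.

Lemma cchain_disjoint s t : 2 <= t - s <= L - 2 -> U s `&` U t = set0.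
Proof.
move=> h; rewrite -subset0 => x [Us Ut].
by have [] := cchain_adjacent_gap Us Ut; lia.
Qed.

Lemma cchain_cover_from a x : exists2 t, a <= t < a + L & F t x.
Proof.
have [t Ft] := cchain_cover ch x.
have L0 : 0 < L by lia.
have [k hk] := int_reduce a t L0.
exists (t - k * L) => //.
by rewrite -mulNr (periodic_mulz (cchain_periodicF ch)).
Qed.

(** Without the link [t], the other [L - 1] links would form a linear chain. *)
Lemma cchain_nonempty t : F t !=set0.
Proof.
apply: contrapT => nF.
have notF x : ~ F t x by move=> Fx; apply: nF; exists x.
apply: (@not_chainable (t + L - 1 - (t + 1)) (fun i => F (i + (t + 1)))).
apply: lchain_interval; first by lia.
- by move=> i _; exact: (cchain_closed ch).
- move=> i j h1 h2 h3; rewrite -subset0 => x [Fi Fj].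
  rewrite -(@cchain_disjoint i j); last by lia.
  by split; apply: (cchain_sub ch).
- move=> x; have [i hi Fi] := cchain_cover_from t x.
  exists i => //; have [it|//] := eqVneq i t; last by lia.
  by rewrite it in Fi; case: (notF x).
- by move=> i x y _ Fx Fy; apply: (cchain_mesh ch (t := i)); apply: (cchain_sub ch).
Qed.

(* If no continuum crosses the arc from [p] to [q], cutting the circle along
   the resulting separation unrolls it into a linear chain. *)
Lemma cchain_crossing p q : p < q -> q - p <= L - 2 -> exists A,
  [/\ subcontinuum A, A `<=` seg F p q, A `&` F p !=set0 & A `&` F q !=set0].
Proof.
move=> pq qpL.
have FU i x : F i x -> U i x by move=> Fx; exact: (cchain_sub ch Fx).
have [|||||[A [cA clA AK Aa Ab]]|[C [[CK clC clKC] aC Cb]]] :=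
    @connected_or_clopen R X cX (seg F p q) (F p) (F q).
- by apply: seg_closed => j _; exact: (cchain_closed ch).
- exact: (cchain_closed ch).
- exact: (cchain_closed ch).
- by move=> x Gx; exists p => //; lia.
- by move=> x Gx; exists q => //; lia.
- have [x [Ax Gx]] := Aa; exists A; split=> //.
  split=> //; first by exists x.
  by apply: (subclosed_compact clA cX).
exfalso.
(* The arc is used twice, one turn apart: its part outside [C] opens the linear chain and its part
   inside [C] closes it. As [F p] lies in [C] and [F q] misses [C], the indices run from [p + 1] to
   [q - 1 + L]. Links about a full turn apart could meet only on the arc, where [C] and its
   complement keep them disjoint. *)
pose G j := if j <= q then (seg F p q `\` C) `&` F j else
            if j < p + L then F j else C `&` F j.
apply: (@not_chainable (q - 1 + L - (p + 1)) (fun i => G (i + (p + 1)))).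
have GF j x : G j x -> F j x by rewrite /G; case: ifP => _; [case|case: ifP => _ //; case].
apply: lchain_interval; first by lia.
- move=> j _; rewrite /G; case: ifP => _; first by apply: closedI => //; exact: (cchain_closed ch).
  by case: ifP => _; [|apply: closedI => //]; exact: (cchain_closed ch).
- move=> i j pi jq ij; rewrite -subset0 => x [Gi Gj].
  have [h|h] := cchain_adjacent_gap (FU _ _ (GF _ _ Gi)) (FU _ _ (GF _ _ Gj)) ltac:(lia) ltac:(lia).
    by lia.
  move: Gi Gj; rewrite /G.
  have -> : (i <= q) = true by lia.
  have -> : (j <= q) = false by lia.
  have -> : (j < p + L) = false by lia.
  by move=> [[_ nC] _] [].
- move=> x; have [i hi Fi] := cchain_cover_from p x.
  have [qi|iq] := ltP q i.
    exists i; first by lia.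
    rewrite /G; have -> : (i <= q) = false by lia.
    by have -> : (i < p + L) = true by lia.
  have Kx : seg F p q x by exists i => //; lia.
  have [Cx|nC] := pselect (C x).
    have iq' : i != q.
      by apply/eqP => E; rewrite E in Fi; have : (C `&` F q) x by []; rewrite Cb.
    exists (i + L); first by lia.
    rewrite /G; have -> : (i + L <= q) = false by lia.
    have -> : (i + L < p + L) = false by lia.
    by rewrite (cchain_periodicF ch).
  have ip : i != p by apply/eqP => E; rewrite E in Fi; exact/nC/aC.
  exists i; first by lia.
  by rewrite /G; have -> : (i <= q) = true by lia.
- by move=> i x y _ /GF/FU Fx /GF/FU Fy; apply: (cchain_mesh ch (t := i)).
Qed.

Lemma cchain_full_turn A p q : p + L - 1 <= q -> A `<=` seg U p q.
Proof.
move=> pq x _; have [t ht Ft] := cchain_cover_from p x.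
by exists t; [lia|exact: (cchain_sub ch)].
Qed.

Lemma cchain_meets_between A lo hi i k j : connected A -> hi - lo <= L - 2 ->
  A `<=` seg U lo hi -> lo <= i < k -> k < j <= hi ->
  A `&` U i !=set0 -> A `&` U j !=set0 -> A `&` U k !=set0.
Proof.
move=> cA hl AU hi' hj; apply: (@connected_meets_between R X A U lo hi) => //.
- by move=> l _; exact: (cchain_open ch).
- by move=> l m hl' hm; apply: cchain_disjoint; lia.
Qed.

Lemma cchain_traced : traced U.
Proof.
move=> p q pq.
have FU i x : F i x -> U i x by move=> Fx; exact: (cchain_sub ch Fx).
have [pqE|pnq] := eqVneq p q.
  have [x Fx] := cchain_nonempty p; exists [set x]; split.
  - by split; [exists x|exact: compact_set1|exact: connected1].
  - by move=> _ ->; exists p; [lia|exact: FU].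
  - by move=> i hi; exists x; split=> //; rewrite (_ : i = p); [exact: FU|lia].
(* An interval of at least [L] links is a full turn and is traced by [X] itself. *)
have [qpL|qpL] := leP (q - p) (L - 2); last first.
  exists [set: X]; split.
  - by split=> //; have [x _] := cchain_nonempty p; exists x.
  - by apply: cchain_full_turn; lia.
  - by move=> i _; have [x Fx] := cchain_nonempty i; exists x; split=> //; exact: FU.
have [|A [sA AK [x [Ax Fx]] [y [Ay Fy]]]] := cchain_crossing _ qpL; first by lia.
have AU : A `<=` seg U p q by move=> z /AK[i hi Fi]; exists i => //; exact: FU.
have Up : A `&` U p !=set0 by exists x; split=> //; exact: FU.
have Uq : A `&` U q !=set0 by exists y; split=> //; exact: FU.
exists A; split=> // i hi.
have [->//|ip] := eqVneq i p; have [->//|iq] := eqVneq i q.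
have [_ _ cA] := sA.
by apply: (@cchain_meets_between A p q p i q) => //; lia.
Qed.

(** If [A] meets every link, one more turn is added. Otherwise the circle is cut at a missed link,
    and the remaining links behave like a linear chain. *)
Lemma cchain_extendable : extendable U.
Proof.
move=> A p q cA pq Am.
have [all|] := pselect (forall t, A `&` U t !=set0).
  exists p, (q + L); split; [by []|lia| |by []].
  by apply: cchain_full_turn; lia.
move=> /existsNP[c0 nc0].
(* [c] is the last copy of the missed index before [p], so [[p, q]] lies strictly between [c] and
   [c + L]. *)
have [|k hk] := @int_reduce L (p - L) c0; first by lia.
set c : int := c0 - k * L in hk.
have UE (t m : int) : U (t + m * L) = U t by exact: periodic_mulz (cchain_periodic ch) _ _.
have nc : ~ (A `&` U c !=set0) by rewrite /c -mulNr UE.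
have ncL : ~ (A `&` U (c + L) !=set0) by rewrite (cchain_periodic ch).
have qc : q < c + L.
  by rewrite ltNge; apply/negP => h; apply: ncL; apply: Am; lia.
have AU : A `<=` seg U (c + 1) (c + L - 1).
  move=> x Ax; have [t ht Ft] := cchain_cover_from c x.
  exists t; last exact: (cchain_sub ch).
  have [tc|] := eqVneq t c; last by lia.
  by exfalso; apply: nc; exists x; split=> //; rewrite -tc; exact: (cchain_sub ch).
pose S i := A `&` U i !=set0.
have [|a [ha Sa amin]] := @int_min (fun a => forall i, a <= i <= p -> S i) (c + 1) p ltac:(lia).
  by move=> i hi; apply: Am; lia.
have [|b [hb Sb bmax]] := @int_max (fun b => forall i, q <= i <= b -> S i) (c + L - 1) q ltac:(lia).
  by move=> i hi; apply: Am; lia.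
have Sall i : a <= i <= b -> S i.
  move=> hi; have [ip|pi] := leP i p; first by apply: Sa; lia.
  have [iq|qi] := leP i q; first by apply: Am; lia.
  by apply: Sb; lia.
have na i : c + 1 <= i < a -> ~ S i.
  move=> hi Si.
  have nS : ~ S (a - 1).
    move=> Sa1; apply: (amin (a - 1)); first by lia.
    by move=> j hj; have [->//|ja] := eqVneq j (a - 1); apply: Sa; lia.
  have [ia|ia] := eqVneq i (a - 1); first by rewrite ia in Si.
  apply: nS; apply: (@cchain_meets_between A (c + 1) (c + L - 1) i (a - 1) p) => //; try lia.
  by apply: Am; lia.
have nb i : b < i <= c + L - 1 -> ~ S i.
  move=> hi Si.
  have nS : ~ S (b + 1).
    move=> Sb1; apply: (bmax (b + 1)); first by lia.
    by move=> j hj; have [->//|jb] := eqVneq j (b + 1); apply: Sb; lia.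
  have [ib|ib] := eqVneq i (b + 1); first by rewrite ib in Si.
  apply: nS; apply: (@cchain_meets_between A (c + 1) (c + L - 1) q (b + 1) i) => //; try lia.
  by apply: Am; lia.
exists a, b; split; [lia|lia| |exact: Sall].
move=> x Ax; have [i hi Ui] := AU _ Ax; exists i => //.
apply/andP; split; rewrite leNgt; apply/negP => h.
  by apply: (na i); [lia|exists x].
by apply: (nb i); [lia|exists x].
Qed.

Lemma cchain_stage : stage e U L.
Proof.
split.
- by lia.
- exact: cchain_periodic ch.
- by move=> t; have [x Fx] := cchain_nonempty t; exists x; exact: (cchain_sub ch).
- by move=> t x y; exact: (cchain_mesh ch).
- exact: cchain_consecutive ch.
- by move=> x; have [t Ft] := cchain_cover ch x; exists t; exact: (cchain_sub ch).
- exact: cchain_traced.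
- exact: cchain_extendable.
Qed.

End OneChain.

Definition circular_cover W (P : int) := circular_adjacency W P /\
  exists2 r, 0 < r & forall x, exists t, forall y, d x y < r -> W t y.

Lemma circular_cover_shift W P s :
  circular_cover W P -> circular_cover (fun t => W (t + s)) P.
Proof.
move=> [adj [r r0 h]]; split.
  move=> t u /adj[m hm]; exists m.
  by have -> : u - t + m * P = u + s - (t + s) + m * P by lia.
exists r => // x; have [t Wt] := h x; exists (t - s) => y.
by rewrite subrK; exact: Wt.
Qed.

Lemma circular_cover_opp W P :
  circular_cover W P -> circular_cover (fun t => W (- t)) P.
Proof.
move=> [adj [r r0 h]]; split.
  by move=> t u /adj[m hm]; exists (- m); lia.
exists r => // x; have [t Wt] := h x; exists (- t) => y.
by rewrite opprK; exact: Wt.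
Qed.

Variable e0 : R.
Hypothesis e00 : 0 < e0.
Hypothesis not_chainable : forall N G, ~ lchain e0 N G.
Hypothesis X2 : exists x y : X, x <> y.
Hypothesis circ : circularly_chainable X.

Lemma circular_stage e : 0 < e -> exists W P, stage e W P /\ circular_cover W P.
Proof.
move=> e_gt0; have [x [y xy]] := X2.
have dxy : 0 < d x y by rewrite mdist_gt0; apply/eqP.
(* The bound [e0] excludes linear chains of mesh [e1], and [d x y / 2] forces at least four
   links. *)
pose e1 := Order.min (Order.min e e0) (d x y / 2).
have e10 : 0 < e1 by rewrite !lt_min e_gt0 e00/=; lra.
have e1e : e1 <= e by rewrite !ge_min lexx.
have e1e0 : e1 <= e0 by rewrite !ge_min lexx orbT.
have e1d : e1 <= d x y / 2 by rewrite ge_min lexx orbT.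
have [n [U [cU covU]]] := circ e10.
have [|L [F [V ch]]] := circular_chain_cchain cU covU; first by exists x, y; lra.
have nch N G : ~ lchain e1 N G.
  move=> l; apply: (@not_chainable N G); split.
  - exact: lchain_ge0 l.
  - exact: lchain_closed l.
  - exact: lchain_disjoint l.
  - exact: lchain_cover l.
  - move=> i z w hi Gz Gw; apply: lt_le_trans e1e0.
    exact: (lchain_mesh l hi Gz Gw).
have st := cchain_stage ch nch.
exists V, L; split; first exact: stage_le e1e st.
by split; [exact: cchain_adjacency ch|exact: cchain_lebesgue ch].
Qed.

(** Path lifting from the circle of coarse links to the integers: consecutive fine links project to
    indices adjacent modulo [P], and the sum of these unit steps is [Phi]. The increment [D] is [P]
    times the winding number of the fine chain in the coarse one. *)
Lemma circular_lift e W P e' W' P' : stage e W P -> circular_adjacency W P ->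
  stage e' W' P' -> (forall t, exists s, W' t `<=` W s) ->
  exists Phi D, [/\ forall t, `|Phi (t + 1) - Phi t| <= 1,
    forall t, W' t `<=` W (Phi t) & forall t, Phi (t + P') = Phi t + D].
Proof.
move=> st adj st' sub; have P'0 := stage_period_gt0 st'.
have [f0 f0P] := choice sub.
pose f t := f0 (t %% P')%Z.
have fper t : f (t + P') = f t by rewrite /f modzDr.
have fP t : W' t `<=` W (f t).
  rewrite /f; have -> : W' t = W' (t %% P')%Z.
    have := divz_eq t P'; set k := (t %/ P')%Z => {1}->; rewrite addrC.
    exact: periodic_mulz (stage_periodic st') _ _.
  exact: f0P.
have /choice[g gP] t : exists s : int, `|s| <= 1 /\ exists m, f t + s = f (t + 1) + m * P.
  have [|m hm] := adj (f t) (f (t + 1)).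
    have [x [x1 x2]] := stage_consecutive st' t.
    by exists x; split; exact: fP.
  by exists (f (t + 1) - f t + m * P); split=> //; exists m; lia.
(* Choosing the step on representatives makes it periodic, so that [Phi] grows by the same amount
   over every period. *)
pose s t := g (t %% P')%Z.
have sper t : s (t + P') = s t by rewrite /s modzDr.
have fmod t : f (t %% P')%Z = f t by rewrite /f modz_mod.
have fmod1 t : f ((t %% P')%Z + 1) = f (t + 1) by rewrite /f modzDml.
have sP t : `|s t| <= 1 /\ exists m, f t + s t = f (t + 1) + m * P.
  by have := gP (t %% P')%Z; rewrite fmod fmod1.
have [Phi Phi0 PhiS] := int_antiderivative s (f 0).
have PhiB t : Phi (t - 1) = Phi t - s (t - 1).
  by have := PhiS (t - 1); rewrite subrK => ->; rewrite addrK.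
have int_ind (Q : int -> Prop) : Q 0 -> (forall t, Q t -> Q (t + 1)) ->
    (forall t, Q t -> Q (t - 1)) -> forall t, Q t.
  move=> Q0 Qs Qp [] n.
    by elim: n => [//|n IH]; rewrite (_ : n.+1%:Z = n%:Z + 1); [exact: Qs|lia].
  rewrite NegzE; elim: n => [|n IH]; first by rewrite (_ : - 1%:Z = 0 - 1); [exact: Qp|lia].
  by rewrite (_ : - n.+2%:Z = - n.+1%:Z - 1); [exact: Qp|lia].
exists Phi, (Phi P' - Phi 0); split.
- move=> t; rewrite PhiS; have [h _] := sP t.
  by have -> : Phi t + s t - Phi t = s t by lia.
- have cong t : exists m, Phi t = f t + m * P.
    elim/int_ind: t => [|t [m hm]|t [m hm]].
    + by exists 0; rewrite Phi0 mul0r addr0.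
    + have [_ [k hk]] := sP t; exists (m + k); rewrite PhiS hm.
      by rewrite mulrDl; move: hk; move: (s t) (f t) (f (t + 1)) (k * P) (m * P); lia.
    + have [_ [k hk]] := sP (t - 1); rewrite subrK in hk.
      exists (m - k); rewrite PhiB hm.
      by rewrite mulrBl; move: hk; move: (s _) (f t) (f _) (k * P) (m * P); lia.
  move=> t x W'x; have [m ->] := cong t.
  by rewrite (periodic_mulz (stage_periodic st)); exact: fP.
- elim/int_ind => [|t IH|t IH].
  + by rewrite add0r; lia.
  + have -> : t + 1 + P' = t + P' + 1 by lia.
    by rewrite !PhiS sper IH; lia.
  + have -> : t - 1 + P' = t + P' - 1 by lia.
    rewrite !PhiB IH.
    have -> : t + P' - 1 = t - 1 + P' by lia.
    by rewrite sper addrAC.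
Qed.

(** If the fine chain winds negatively, its orientation is reversed, so that the drift is
    nonnegative. *)
Lemma circular_refine e W P e' tau0 : stage e W P -> circular_cover W P -> 0 < e' ->
  exists W' P' Phi tau H T,
    [/\ stage e' W' P', circular_cover W' P', tau0 <= tau & refines_at W W' Phi tau H T].
Proof.
move=> st [adjW [r r0 lebW]] e'0.
pose e1 := Order.min e' r.
have e10 : 0 < e1 by rewrite lt_min e'0.
have [W1 [P1 [st1 cov1]]] := circular_stage e10.
have st1' : stage e' W1 P1 by apply: stage_le st1; rewrite ge_min lexx.
have sub t : exists s, W1 t `<=` W s.
  have [x Wx] := stage_nonempty st1 t; have [s Ws] := lebW x.
  exists s => y Wy; apply: Ws.
  by apply: lt_le_trans (stage_mesh st1 Wx Wy) _; rewrite ge_min lexx orbT.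
have [Phi [D [lip subP per]]] := circular_lift st adjW st1' sub.
have [D0|D0] := leP 0 D.
  have [s [Phi' [tau [H [T [h1 h2]]]]]] :=
    refines_at_shift tau0 st st1' lip subP per D0.
  exists (fun t => W1 (t + s)), P1, Phi', tau, H, T; split=> //.
    exact: stage_shift.
  exact: circular_cover_shift.
have [||||s [Phi' [tau [H [T [h1 h2]]]]]] :=
  @refines_at_shift R X e e' W _ P P1 (fun t => Phi (- t)) (- D) tau0 st (stage_opp st1').
- move=> t; have := lip (- (t + 1)); have -> : - (t + 1) + 1 = - t by lia.
  by rewrite distrC.
- by move=> t; exact: subP.
- move=> t; have := per (- (t + P1)); have -> : - (t + P1) + P1 = - t by lia.
  by move=> ->; rewrite addrK.
- by lia.
exists (fun t => W1 (- (t + s))), P1, Phi', tau, H, T; split=> //.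
  exact: (stage_shift s (stage_opp st1')).
exact: (circular_cover_shift s (circular_cover_opp cov1)).
Qed.

End CircularChains.

(** * The spiralling sequence *)

Section Tower.
Variables (R : realType) (X : metricType R).
Hypothesis cX : compact [set: X].
Hypothesis conX : connected [set: X].
Hypothesis X2 : exists x y : X, x <> y.
Hypothesis circ : circularly_chainable X.
Implicit Types (A B : set X) (e r : R).
Local Notation d := (@mdist R X).

(** [Good] adds to a stage the adjacency and Lebesgue data needed for the next refinement, and hides
    which of the two cases holds. If linear chains fail at one scale [e0], they fail at all smaller
    scales, where the circular chains are taken. *)
Lemma refinable_stages : exists Good : R -> (int -> set X) -> int -> Prop,
  [/\ forall e W P, Good e W P -> stage e W P,
   forall e, 0 < e -> exists W P, Good e W P &
   forall e W P e' tau0, Good e W P -> 0 < e' -> exists W' P' Phi tau H T,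
     [/\ Good e' W' P', tau0 <= tau & refines_at W W' Phi tau H T]].
Proof.
have X0 : [set: X] !=set0 by have [x _] := X2; exists x.
have [lin|] := pselect (forall e, 0 < e -> exists N G, @lchain R X e N G).
  exists (fun e W P => stage e W P /\ linear_window W); split.
  - by move=> e W P [].
  - exact: (linear_stage cX conX X0 lin).
  - move=> e W P e' tau0 [st wW] e'0.
    have [W' [P' [Phi [tau [H [T [h1 h2 h3 h4]]]]]]] :=
      linear_refine cX conX X0 lin tau0 st wW e'0.
    by exists W', P', Phi, tau, H, T.
move=> /existsNP[e0 /not_implyP[e00 nlin]].
have nch N G : ~ @lchain R X e0 N G by move=> l; apply: nlin; exists N, G.
exists (fun e W P => stage e W P /\ circular_cover W P); split.
- by move=> e W P [].
- exact: (circular_stage cX conX e00 nch X2 circ).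
- move=> e W P e' tau0 [st wW] e'0.
  have [W' [P' [Phi [tau [H [T [h1 h2 h3 h4]]]]]]] :=
    circular_refine cX conX e00 nch X2 circ tau0 st wW e'0.
  by exists W', P', Phi, tau, H, T.
Qed.

Definition tower_mesh (m : nat) : R := m.+1%:R^-1.

Lemma tower_mesh_gt0 m : 0 < tower_mesh m.
Proof. by rewrite /tower_mesh invr_gt0 ltr0n. Qed.

(** Level [m] lasts a full period of its own cover before the next level starts, which gives
    density. Time [T m] comes before level [m.+2], so that at this time the index at level [m.+1] is
    still the time itself. *)
Lemma tower_exists : exists (W : nat -> int -> set X) (P tau H T : nat -> int)
    (Phi : nat -> int -> int),
  [/\ tau 0%N = 0, forall m, stage (tower_mesh m) (W m) (P m),
   forall m, tau m + P m <= tau m.+1, forall m, T m <= tau m.+2 &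
   forall m, refines_at (W m) (W m.+1) (Phi m) (tau m.+1) (H m) (T m)].
Proof.
have [Good [Gst Gex Gref]] := refinable_stages.
pose level := ((int -> set X) * int * int * int)%type.
pose lW (a : level) := a.1.1.1; pose lP (a : level) := a.1.1.2.
pose ltau (a : level) := a.1.2; pose lT (a : level) := a.2.
pose Rel (m : nat) (a b : level) := [/\ Good (tower_mesh m.+1) (lW b) (lP b),
  ltau a + lP a <= ltau b, lT a <= ltau b &
  exists Phi H, refines_at (lW a) (lW b) Phi (ltau b) H (lT b)].
have step (ma : nat * level) : exists b,
    Good (tower_mesh ma.1) (lW ma.2) (lP ma.2) -> Rel ma.1 ma.2 b.
  case: ma => m a /=.
  have [G|nG] := pselect (Good (tower_mesh m) (lW a) (lP a)); last by exists a.
  have [W' [P' [Phi [tau [H [T [h1 h2 h3]]]]]]] :=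
    Gref _ _ _ _ (Num.max (ltau a + lP a) (lT a)) G (tower_mesh_gt0 m.+1).
  exists (W', P', tau, T) => _; split=> //; rewrite /ltau/= in h2 *.
  - by apply: le_trans h2; rewrite le_max lexx.
  - by apply: le_trans h2; rewrite le_max lexx orbT.
  - by exists Phi, H.
have [f fP] := choice step.
have [W0 [P0 G0]] := Gex _ (tower_mesh_gt0 0).
pose l := fix l m := if m is m'.+1 then f (m', l m') else (W0, P0, 0 : int, 0 : int).
have lG m : Good (tower_mesh m) (lW (l m)) (lP (l m)).
  by elim: m => [//|m IH]; have [] := fP (m, l m) IH.
have lR m : Rel m (l m) (l m.+1) by exact: (fP (m, l m)).
have /choice[PH PHP] m : exists PH : (int -> int) * int,
    refines_at (lW (l m)) (lW (l m.+1)) PH.1 (ltau (l m.+1)) PH.2 (lT (l m.+1)).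
  by have [_ _ _ [Phi [H h]]] := lR m; exists (Phi, H).
(* The last component of a level belongs to the refinement that produced it, whence the shift of
   index in [T]. *)
exists (fun m => lW (l m)), (fun m => lP (l m)), (fun m => ltau (l m)),
  (fun m => (PH m).2), (fun m => lT (l m.+1)), (fun m => (PH m).1); split => //.
- by move=> m; apply: Gst.
- by move=> m; have [] := lR m.
- by move=> m; have [] := lR m.+1.
Qed.

Section OneTower.
Variables (W : nat -> int -> set X) (P tau H T : nat -> int) (Phi : nat -> int -> int).
Hypothesis tau0 : tau 0%N = 0.
Hypothesis st : forall m, stage (tower_mesh m) (W m) (P m).
Hypothesis tauP : forall m, tau m + P m <= tau m.+1.
Hypothesis tauT : forall m, T m <= tau m.+2.
Hypothesis ref : forall m, refines_at (W m) (W m.+1) (Phi m) (tau m.+1) (H m) (T m).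

Lemma tau_lt m : tau m < tau m.+1.
Proof. by have := tauP m; have := stage_period_gt0 (st m); lia. Qed.

Lemma tau_ge m : m%:Z <= tau m.
Proof. by elim: m => [|m IH]; [rewrite tau0|have := tau_lt m; lia]. Qed.

Lemma tau_le m n : (m <= n)%N -> tau m <= tau n.
Proof.
move=> /subnK <-; elim: (n - m)%N => [//|k IH].
by rewrite addSn; apply: le_trans IH (ltW (tau_lt _)).
Qed.

Lemma tau_level t : 0 <= t -> exists m, tau m <= t < tau m.+1.
Proof.
move=> t0; have ex : exists m, tau m <= t by exists 0%N; rewrite tau0.
have bd m : tau m <= t -> (m <= `|t|)%N by move=> h; have := tau_ge m; lia.
have [m tm mmax] := ex_maxnP ex bd; exists m; rewrite tm/= ltNge.
by apply/negP => /mmax; rewrite ltnn.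
Qed.

(* [track m t] is the index, in the cover of level [m], of the link visited at
   time [t]; the fuel [|t|] suffices because [m <= tau m]. *)
Fixpoint track_fuel (k m : nat) (t : int) : int :=
  if k is k'.+1 then
    if t <= tau m.+1 then t else Phi m (track_fuel k' m.+1 t)
  else t.

Definition track (m : nat) (t : int) : int := track_fuel `|t|%N m t.

Lemma track_fuelS k m t : t <= tau (m + k).+1 ->
  track_fuel k.+1 m t = track_fuel k m t.
Proof.
elim: k m => [|k IH] m h; first by rewrite /= addn0 in h *; rewrite h.
rewrite [LHS]/=; case: ifP => tm; first by rewrite /= tm.
by rewrite [RHS]/= tm -[in RHS]IH ?addSnnS.
Qed.

Lemma track_fuel_stable k j m t : t <= tau (m + k).+1 ->
  track_fuel (j + k) m t = track_fuel k m t.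
Proof.
move=> h; elim: j => [//|j IH]; rewrite addSn track_fuelS ?IH//.
by apply: le_trans h (tau_le _); lia.
Qed.

Lemma track_low m t : t <= tau m.+1 -> track m t = t.
Proof. by rewrite /track; case: `|t|%N => [//|k] /= ->. Qed.

Lemma track_high m t : tau m.+1 <= t -> track m t = Phi m (track m.+1 t).
Proof.
rewrite le_eqVlt => /orP[/eqP <-|mt].
  by rewrite !track_low ?(refines_start (ref m))// ltW// tau_lt.
have := tau_ge m.+1 => tm.
rewrite /track; case E : `|t|%N => [|k]; first by lia.
rewrite /= leNgt mt/= -(@track_fuel_stable k 1 m.+1)//.
have := tau_ge (m.+1 + k).+1; lia.
Qed.

(** Induction from fine levels to coarse ones: [m <= tau m] makes every fixed time initial for fine
    enough levels. *)
Lemma track_ind (Q : nat -> int -> Prop) :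
  (forall m t, t <= tau m.+1 -> Q m t) ->
  (forall m t, tau m.+1 <= t -> Q m.+1 t -> Q m t) -> forall m t, Q m t.
Proof.
move=> Q0 QS m t; have : t <= tau (m + `|t|).+1.
  by have := tau_ge (m + `|t|).+1; lia.
elim: `|t|%N m => [|k IH] m h; first by apply: Q0; rewrite addn0 in h.
have [tm|mt] := leP t (tau m.+1); first exact: Q0.
by apply: QS; [exact: ltW|apply: IH; rewrite addSnnS].
Qed.

Lemma track_ge m t : tau m <= t -> tau m <= track m t.
Proof.
move: m t; apply: track_ind => m t tm; first by rewrite track_low.
move=> IH mt; rewrite track_high//.
apply: le_trans (refines_ge (ref m) (IH tm)).
by have := tau_lt m; lia.
Qed.

Lemma track_geS m t : tau m.+1 <= t -> tau m.+1 <= track m t.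
Proof.
by move=> h; rewrite track_high//; apply: refines_ge (ref m) _ _; exact: track_ge.
Qed.

Lemma track_step m t : tau m <= t -> `|track m (t + 1) - track m t| <= 1.
Proof.
move: m t; apply: track_ind => m t tm.
  move=> mt; have [tm1|mt1] := leP (t + 1) (tau m.+1).
    by rewrite !track_low//; lia.
  (* The one step across the change of level; [refines_start] makes both descriptions of the track
     agree at this time. *)
  have tE : t = tau m.+1 by lia.
  rewrite track_high ?[track m t]track_high; [|by lia|by lia].
  rewrite tE [track m.+1 (tau m.+1)]track_low; last by have := tau_lt m.+1; lia.
  rewrite [track m.+1 (_ + 1)]track_low; last by have := tau_lt m.+1; lia.
  exact: (refines_step (ref m)).
move=> IH mt; have {}IH := IH tm.
rewrite track_high ?[track m t]track_high//; last by lia.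
have a_ge := track_ge tm; have b_ge : tau m.+1 <= track m.+1 (t + 1).
  by apply: track_ge; lia.
move: IH a_ge b_ge; set a := track m.+1 t; set b := track m.+1 (t + 1) => IH a_ge b_ge.
have [ba|[ba|ba]] : b = a + 1 \/ a = b + 1 \/ a = b by lia.
- by rewrite ba; exact: (refines_step (ref m)).
- by rewrite ba distrC; exact: (refines_step (ref m)).
- by rewrite ba subrr.
Qed.

Lemma track_reach m : track m (T m) = tau m.+1 + H m.
Proof.
rewrite track_high; last exact: refines_time (ref m).
by rewrite track_low ?(refines_reach (ref m)).
Qed.

(** The point is chosen in the link of the finest level active at time [t]; the refinements place it
    in the tracked links of all coarser levels. Negative times precede every level and get an
    arbitrary point. *)
Lemma track_point : exists x : int -> X,
  forall m t, tau m <= t -> W m (track m t) (x t).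
Proof.
have /choice[x xP] t : exists x, forall m, tau m <= t -> W m (track m t) x.
  have [t0|t0] := leP 0 t; last first.
    have [x _] := X2; exists x => m mt.
    by have := tau_ge m; lia.
  have [n /andP[nt tn]] := tau_level t0.
  have [x Wx] := stage_nonempty (st n) (track n t); exists x => m mt.
  have mn : (m <= n)%N.
    by rewrite leqNgt; apply/negP => nm; have := tau_le nm; lia.
  have down k : (k <= n)%N -> W (n - k)%N (track (n - k)%N t) x.
    elim: k => [|k IH] kn; first by rewrite subn0.
    have {}IH := IH (ltnW kn).
    have E : (n - k)%N = (n - k.+1).+1 by lia.
    rewrite E in IH.
    have tk : tau (n - k.+1).+1 <= t by apply: le_trans (tau_le _) nt; lia.
    rewrite track_high//.
    by apply: (refines_sub (ref _)) IH; exact: track_ge.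
  by have := down (n - m)%N; rewrite subKn//; apply; lia.
by exists x => m t; exact: xP.
Qed.

Variable x : int -> X.
Hypothesis xP : forall m t, tau m <= t -> W m (track m t) (x t).

Definition orbit_seg (p q : int) : set X := [set y | exists2 t, p <= t <= q & y = x t].

Lemma full_meets_close m A lo hi :
  (forall y, exists2 i, lo <= i <= hi & W m i y) ->
  (forall i, lo <= i <= hi -> A `&` W m i !=set0) ->
  hclose (tower_mesh m) A [set: X].
Proof.
move=> cov meets; split=> [a Aa|y _].
  by exists a => //; rewrite mdistxx ltW// tower_mesh_gt0.
have [i hi' Wi] := cov y; have [a [Aa Wa]] := meets i hi'.
by exists a => //; apply: ltW; exact: (stage_mesh (st m) Wa Wi).
Qed.

Lemma orbit_seg_full m lo hi p q :
  (forall y, exists2 i, lo <= i <= hi & W m i y) -> p <= q -> tau m <= p ->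
  (forall i, lo <= i <= hi -> exists2 t, p <= t <= q & track m t = i) ->
  hclose (tower_mesh m) (orbit_seg p q) [set: X].
Proof.
move=> cov pq mp onto; apply: (@full_meets_close m _ lo hi) => //.
move=> i /onto[t ht <-]; exists (x t); split; first by exists t.
by apply: xP; lia.
Qed.

Lemma hclose_setT2 e A B : hclose e A [set: X] -> hclose e B [set: X] ->
  hclose (2 * e) A B.
Proof.
move=> hA hB; have -> : 2 * e = e + e by lra.
exact: hclose_trans hA (hclose_sym hB).
Qed.

Lemma seg_orbit_close m A lo hi p q : tau m <= p ->
  A `<=` seg (W m) lo hi -> (forall i, lo <= i <= hi -> A `&` W m i !=set0) ->
  (forall t, p <= t <= q -> lo <= track m t <= hi) ->
  (forall i, lo <= i <= hi -> exists2 t, p <= t <= q & track m t = i) ->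
  hclose (tower_mesh m) A (orbit_seg p q).
Proof.
move=> mp Asub meets into onto; split=> [a Aa|_ [t ht ->]].
  have [i hi' Wi] := Asub a Aa; have [t ht ti] := onto i hi'.
  exists (x t); first by exists t.
  by apply: ltW; apply: (stage_mesh (st m) Wi); rewrite -ti; apply: xP; lia.
have [a [Aa Wa]] := meets _ (into t ht); exists a => //.
by apply: ltW; apply: (stage_mesh (st m) Wa); apply: xP; lia.
Qed.

(** After [p] the track never drops below [p]: it is the identity up to [tau m.+1] and stays above
    [tau m.+1] from then on. Going back from [p] to [a] therefore adds just the indices between
    them. *)
Lemma track_seg m p q : tau m <= p <= tau m.+1 -> p <= q ->
  exists2 s, p <= s <= q &
    (forall t, p <= t <= q -> p <= track m t <= track m s) /\
    (forall a i, tau m <= a <= p -> a <= i <= track m s ->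
      exists2 t, a <= t <= s & track m t = i).
Proof.
move=> /andP[mp pm] pq; have [s hs smax] := walk_max (track m) pq.
exists s => //; split.
  move=> t ht; rewrite smax// andbT.
  have [tm|mt] := leP t (tau m.+1); first by rewrite track_low//; lia.
  by have := @track_geS m t; lia.
move=> a i ha hi; apply: walk_onto; first by lia.
  by move=> t ht; apply: track_step; lia.
by rewrite [track m a]track_low//; lia.
Qed.

(** The links met on [[p, q]] form an interval [[p, b]], which [stage_extendable] enlarges to
    [[a', b']]. New links on the left are visited at the times from [a'] to [p], those on the right
    by running on. If [a'] precedes the level, either [p] ends the level and [A] meets a full
    period, or the second alternative allows the argument to be resumed one level lower. *)
Lemma track_extension m p q A : tau m <= p <= tau m.+1 -> p <= q -> connected A ->
  (forall t, p <= t <= q -> A `&` W m (track m t) !=set0) ->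
  (exists p' q', [/\ tau m <= p' <= p, q <= q' &
     hclose (2 * tower_mesh m) A (orbit_seg p' q')]) \/
  [/\ p != tau m.+1 &
   forall t, tau m <= t <= q -> A `&` W m (track m t) !=set0].
Proof.
move=> hp pq cA meets.
have [s hs [into onto]] := track_seg hp pq.
set b := track m s in into onto.
have Am i : p <= i <= b -> A `&` W m i !=set0.
  move=> hi; have [|t ht <-] := onto p i _ hi; first by lia.
  by apply: meets; lia.
have pb : p <= b by have := into s hs; lia.
have [a' [b' [a'p bb' AW Am']]] := stage_extendable (st m) cA pb Am.
have covH := refines_full (ref m); have H0 := refines_height (ref m).
have Ttau := refines_time (ref m); have reach := track_reach m.
have full p' q' : tau m <= p' -> p' <= p -> p' <= tau m.+1 -> T m <= q' -> a' <= tau m.+1 ->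
    tau m.+1 + H m <= b' -> hclose (2 * tower_mesh m) A (orbit_seg p' q').
  move=> h1 h2 h3 h4 h5 h6; apply: hclose_setT2.
    by apply: (full_meets_close covH) => i hi; apply: Am'; lia.
  apply: (orbit_seg_full covH) => //; first by lia.
  move=> i hi; have [|||t ht <-] := @walk_onto (track m) (tau m.+1) (T m) i => //.
  - by move=> t ht; apply: track_step; lia.
  - by rewrite track_low// reach.
  by exists t => //; lia.
have [ma'|a'm] := leP (tau m) a'; last first.
  have [pE|pn] := eqVneq p (tau m.+1); last first.
    right; split=> // t ht; have [tp|pt] := leP t p.
      by apply: Am'; rewrite track_low; lia.
    by apply: Am'; have := into t; lia.
  left; exists (tau m), q; split; [lia|by []|].
  have tP := tauP m.
  have cov y : exists2 i, tau m <= i <= tau m.+1 & W m i y.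
    by have [i hi Wi] := stage_cover_period (tau m) y (st m); exists i => //; lia.
  apply: hclose_setT2.
    by apply: (full_meets_close cov) => i hi; apply: Am'; lia.
  apply: (orbit_seg_full cov) => //; first by lia.
  by move=> i hi; exists i; [lia|rewrite track_low//; lia].
left.
(* Then [A] meets a family of links covering [X], and the ray does so as well once it runs up to
   [T m]. *)
have [bH|Hb] := leP (tau m.+1 + H m) b'.
  exists p, (Num.max q (T m)); split; [lia|by rewrite le_max lexx|].
  by apply: full => //; [lia|lia|rewrite le_max lexx orbT|lia].
(* The walk is stopped when it first reaches [b'], so that it has not gone beyond; this happens by
   [T m], where it is above [b']. *)
have [q' [q'q [s' [ps' s'q' sE into']]]] : exists q', q <= q' /\ exists s',
    [/\ p <= s', s' <= q', track m s' = b' & forall t, p <= t <= q' -> p <= track m t <= b'].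
  have [bE|bn] := eqVneq b b'.
    by exists q; split=> //; exists s; split; [lia|lia|exact: bE|rewrite -bE].
  have qT : q <= T m.
    rewrite leNgt; apply/negP => Tq; have := into (T m); rewrite reach; lia.
  have [||s' [h1 h2 h3]] := @walk_first (track m) q (T m) b' qT.
  - by move=> t ht; apply: track_step; lia.
  - by rewrite reach; have := into q; lia.
  exists s'; split; first by lia.
  exists s'; split=> //; first by lia.
  move=> t ht; have [tq|qt] := leP t q; first by have := into t; lia.
  have := h3 t; have [tm|mt] := leP t (tau m.+1); first by rewrite track_low//; lia.
  by have := @track_geS m t; lia.
exists a', q'; split; [lia|by []|].
apply: (@hclose_le _ _ (tower_mesh m)); first by have := tower_mesh_gt0 m; lra.
apply: (seg_orbit_close ma' AW Am').
  move=> t ht; have [tp|pt] := leP t p; first by rewrite track_low//; lia.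
  by have := into' t; lia.
move=> i hi; have [|||t ht <-] := @walk_onto (track m) a' s' i.
- by lia.
- by move=> t ht; apply: track_step; lia.
- by rewrite sE track_low//; lia.
by exists t => //; lia.
Qed.

Lemma orbit_traced m p q : tau m <= p < tau m.+1 -> p <= q -> exists A,
  [/\ subcontinuum A, hclose (tower_mesh m) A (orbit_seg p q) &
   forall t, p <= t <= q -> A `&` W m (track m t) !=set0].
Proof.
move=> hp pq; have hp' : tau m <= p <= tau m.+1 by lia.
have [s hs [into onto]] := track_seg hp' pq.
have pb : p <= track m s by have := into s hs; lia.
have [A [sA AW Am]] := stage_traced (st m) pb.
exists A; split=> //; last by move=> t ht; apply: Am; exact: into.
apply: (seg_orbit_close _ AW Am) => //; first by lia.
move=> i hi; have [|t ht <-] := onto p i _ hi; first by lia.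
by exists t => //; lia.
Qed.

(** Level [m] is the reserve for running out of level [m.+1] on the left: there the piece starts at
    [tau m.+1], which excludes the second alternative. *)
Lemma orbit_extension m p q A : tau m.+1 <= p < tau m.+2 -> p <= q -> connected A ->
  (forall t, p <= t <= q -> A `&` W m.+1 (track m.+1 t) !=set0) ->
  exists p' q', [/\ tau m <= p' <= p, q <= q' &
    hclose (2 * tower_mesh m) A (orbit_seg p' q')].
Proof.
move=> hp pq cA meets; have tm := tau_lt m.
have ee : tower_mesh m.+1 <= tower_mesh m.
  by rewrite /tower_mesh lef_pV2 ?posrE ?ltr0n// ler_nat.
have [|[p' [q' [h1 h2 h3]]]|[_ meets']] := @track_extension m.+1 p q A _ pq cA meets.
- by lia.
- exists p', q'; split=> //; first by lia.
  by apply: hclose_le h3; lra.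
have [||||[p' [q' [h1 h2 h3]]]|[]] := @track_extension m (tau m.+1) q A.
- by lia.
- by lia.
- by [].
- move=> t ht; have [|a [Aa Wa]] := meets' t; first by lia.
  exists a; split=> //; rewrite track_high; last by lia.
  by apply: (refines_sub (ref m)) Wa; apply: track_ge; lia.
- by exists p', q'; split=> //; lia.
- by rewrite eqxx.
Qed.

Lemma orbit_step m t : tau m <= t -> d (x t) (x (t + 1)) <= 2 * tower_mesh m.
Proof.
move=> mt; have := track_step mt.
have Wt := xP mt; have Wt1 : W m (track m (t + 1)) (x (t + 1)) by apply: xP; lia.
move: Wt Wt1; set a := track m t; set b := track m (t + 1) => Wt Wt1 ab.
have [z [za zb]] : W m a `&` W m b !=set0.
  have [E|[E|E]] : b = a + 1 \/ a = b + 1 \/ a = b by lia.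
  - by rewrite E; exact: (stage_consecutive (st m)).
  - by rewrite E setIC; exact: (stage_consecutive (st m)).
  - by exists (x t); split=> //; rewrite -E.
have := stage_mesh (st m) Wt za; have := stage_mesh (st m) zb Wt1.
by have := metric_triangle (x t) z (x (t + 1)); lra.
Qed.

Lemma orbit_dense m y : exists2 t, tau m <= t & d (x t) y < tower_mesh m.
Proof.
have [t ht Wt] := stage_cover_period (tau m) y (st m).
have tP := tauP m; exists t; first by lia.
apply: (stage_mesh (st m) _ Wt).
by rewrite -[X in W _ X](@track_low m); [apply: xP|]; lia.
Qed.

End OneTower.

Lemma compact_bounded : exists2 D : R, 0 < D & forall y z, d y z <= D.
Proof.
have [x0 _] := X2; have [D DP] : exists D : R, forall y, d x0 y <= D.
  have := cX; move=> /compact_near_coveringP/(_ R (+oo : set_system R) (fun M y => d x0 y <= M)).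
  case=> [y _|M [Mr h]].
    exists ([set z | d y z < 1], [set M | d x0 y + 1 < M]).
      split=> /=; first by apply/near_mdistP; exists 1.
      by exists (d x0 y + 1); split=> //; rewrite num_real.
    by move=> [z M]/= [yz xM]; have := metric_triangle x0 y z; lra.
  by exists (M + 1) => y; apply: h => //; lra.
exists (2 * `|D| + 1); first by have := normr_ge0 D; lra.
move=> y z; have := metric_triangle y x0 z; rewrite (metric_sym y x0).
by have := DP y; have := DP z; have := ler_norm D; lra.
Qed.

Definition nseg (x : nat -> X) (p q : nat) : set X :=
  [set y | exists2 t, (p <= t <= q)%N & y = x t].

(** All that the compactification needs from the tower. Steps and heights are bounded from [p'] on,
    not only from [p], because the enlarged piece of ray starts at [p']. *)
Theorem tracking : exists (x : nat -> X) (eta : nat -> R),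
  [/\ forall e, 0 < e -> exists N, forall n, (N <= n)%N -> eta n <= e,
   forall e N y, 0 < e -> exists2 k, (N <= k)%N & d (x k) y < e &
   forall p q, (p <= q)%N -> exists A, [/\ subcontinuum A,
     hclose (eta p) A (nseg x p q) &
     forall A', subcontinuum A' -> A `<=` A' -> exists p' q',
      [/\ (p' <= p)%N, (q <= q')%N, hclose (eta p) A' (nseg x p' q'),
       forall k, (p' <= k)%N -> d (x k) (x k.+1) <= eta p &
       forall k, (p' <= k)%N -> k.+1%:R^-1 <= eta p]]].
Proof.
have [W [P [tau [H [T [Phi [tau0 st tauP tauT ref]]]]]]] := tower_exists.
have [x xP] := track_point tau0 st tauP ref.
have [D D0 DP] := compact_bounded.
have lev0 (p : nat) := tau_level tau0 st tauP (t := p%:Z) (ltac:(by [])).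
have [lev levP] := choice lev0.
(* An enlargement may drop one level, hence the mesh of the level below. Level 0 has none below: [D]
   bounds all distances there and 1 bounds all heights. *)
pose eta p := if lev p is m.+1 then 2 * tower_mesh m else D + 1.
have segE p q : orbit_seg x p%:Z q%:Z = nseg (fun n => x n%:Z) p q.
  apply/seteqP; split=> y [t ht ->].
    by exists `|t|%N; [lia|congr x; lia].
  by exists t%:Z => //; lia.
have small e : 0 < e -> exists N : nat, forall m, (N <= m)%N -> 2 * tower_mesh m <= e.
  move=> e0; have [N hN] : exists N : nat, 2 / e < N%:R.
    by exists (Num.bound (2 / e)); apply: archi_boundP; apply: divr_ge0; lra.
  exists N => m Nm; rewrite /tower_mesh.
  rewrite ler_pdivrMr ?ltr0n//.
  have : N%:R <= m.+1%:R :> R by rewrite ler_nat; lia.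
  by move: hN; rewrite ltr_pdivrMr//; nra.
exists (fun n => x n%:Z), eta; split.
- move=> e e0; have [N hN] := small e e0; exists `|tau N.+1|%N => n Nn.
  rewrite /eta; have := levP n; case: (lev n) => [|m] hn.
    by have := tau_le tau0 st tauP (m := 1) (n := N.+1) isT; lia.
  apply: hN; rewrite leqNgt; apply/negP => mN.
  by have := tau_le tau0 st tauP (m := m.+2) (n := N.+1); lia.
- move=> e N y e0; have [M hM] := small e e0.
  have [t ht ty] := orbit_dense tau0 st tauP xP (maxn N M) y.
  have tn := tau_ge tau0 st tauP (maxn N M).
  exists `|t|%N; first by lia.
  have -> : `|t|%N%:Z = t by lia.
  apply: lt_le_trans ty _; apply: le_trans (hM (maxn N M) _); last by lia.
  by have := tower_mesh_gt0 (maxn N M); lra.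
move=> p q pq.
have [A [sA Aclose Am]] := orbit_traced tau0 st tauP ref xP (q := q%:Z) (levP p) ltac:(lia).
have inv1 k : k.+1%:R^-1 <= 1 :> R.
  by rewrite invf_le1 ?ltr0n// ler1n.
exists A; rewrite segE in Aclose; split=> //.
  apply: hclose_le Aclose; rewrite /eta; case: (lev p) => [|m].
    by have := inv1 0%N; rewrite /tower_mesh; lra.
  have : tower_mesh m.+1 <= tower_mesh m.
    by rewrite /tower_mesh lef_pV2 ?posrE ?ltr0n// ler_nat.
  by have := tower_mesh_gt0 m; lra.
move=> A' sA' AA'; have [A'0 _ cA'] := sA'.
rewrite /eta; have := levP p.
have {Aclose Am} : forall t, p%:Z <= t <= q%:Z ->
    A' `&` W (lev p) (track tau Phi (lev p) t) !=set0.
  by move=> t /Am[a [Aa Wa]]; exists a; split=> //; exact: AA'.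
case: (lev p) => [|m] meets hp.
  exists p, q; split=> //.
  - split=> [a _|b _].
      by exists (x p%:Z); [exists p => //; lia|have := DP a (x p%:Z); lra].
    by have [a A'a] := A'0; exists a => //; have := DP a b; lra.
  - by move=> k _; have := DP (x k%:Z) (x k.+1%:Z); lra.
  - by move=> k _; apply: le_trans (inv1 k) _; lra.
have [p' [q' [h1 h2 h3]]] :=
  orbit_extension tau0 st tauP tauT ref xP (q := q%:Z) hp ltac:(lia) cA' meets.
have p'0 := tau_ge tau0 st tauP m.
have E1 : `|p'|%N%:Z = p' by lia.
have E2 : `|q'|%N%:Z = q' by lia.
exists `|p'|%N, `|q'|%N; split; [lia|lia|by rewrite -segE E1 E2| |].
- move=> k hk; have -> : k.+1%:Z = k%:Z + 1 by lia.
  by apply: (orbit_step tau0 st tauP ref xP); lia.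
- move=> k hk; apply: (@le_trans _ _ (tower_mesh m)).
    by rewrite /tower_mesh lef_pV2 ?posrE ?ltr0n// ler_nat; lia.
  by have := tower_mesh_gt0 m; lra.
Qed.

End Tower.

(** * The compactification *)

Section PiecewiseLinear.
Variable R : realType.
Implicit Types (a : nat -> R) (u v D c e : R).

(** Piecewise linear interpolation of the sequence [a] at the natural numbers. *)
Definition pl a u : R :=
  let k := Num.truncn u in a k + (u - k%:R) * (a k.+1 - a k).

Lemma pl_at a u k : k%:R <= u <= k.+1%:R ->
  pl a u = a k + (u - k%:R) * (a k.+1 - a k).
Proof.
move=> /andP[ku]; rewrite le_eqVlt => /orP[/eqP ->|uk]; last first.
  by rewrite /pl (@truncn_def _ u k) ?ku ?uk.
have kk : (k.+1%:R : R) <= (k.+1%:R : R) < (k.+2%:R : R) by apply/andP; split=> //; rewrite ltr_nat.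
rewrite /pl (truncn_def kk).
have -> : k.+1%:R - k%:R = 1 :> R by rewrite mulrS addrK.
by rewrite subrr mul0r addr0 mul1r addrC subrK.
Qed.

Lemma pl_near a u k c e : k%:R <= u <= k.+1%:R ->
  `|a k - c| <= e -> `|a k.+1 - c| <= e -> `|pl a u - c| <= e.
Proof.
move=> ku; rewrite (pl_at _ ku); move: ku; rewrite -natr1 => /andP[ku uk].
set t := u - k%:R; have t0 : 0 <= t by rewrite /t; lra.
have t1 : t <= 1 by rewrite /t; lra.
rewrite !ler_norml => /andP[h1 h2] /andP[h3 h4].
by apply/andP; split; nra.
Qed.

Lemma pl_lipschitz a D u v : (forall k, `|a k.+1 - a k| <= D) ->
  0 <= u -> u <= v -> `|pl a v - pl a u| <= D * (v - u).
Proof.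
move=> aD u0 uv.
have D0 : 0 <= D by exact: le_trans (aD 0%N).
have local k x y : k%:R <= x -> x <= y -> y <= k.+1%:R ->
    `|pl a y - pl a x| <= D * (y - x).
  move=> kx xy yk; rewrite (@pl_at a x k) ?kx ?(le_trans xy)//.
  rewrite (@pl_at a y k) ?yk ?(le_trans kx)//.
  have -> : a k + (y - k%:R) * (a k.+1 - a k) - (a k + (x - k%:R) * (a k.+1 - a k))
    = (y - x) * (a k.+1 - a k) by lra.
  rewrite normrM ger0_norm ?subr_ge0// mulrC.
  by rewrite ler_wpM2r// subr_ge0.
have /andP[ku uk] := truncn_itv u0; set k := Num.truncn u in ku uk.
have [n] : exists n : nat, v <= k.+1%:R + n%:R.
  exists (Num.truncn v).+1; have := truncnS_gt v; have : 0 <= k.+1%:R :> R by [].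
  by lra.
elim: n v uv => [|n IH] v uv vn; first by apply: (local k); lra.
have [vn'|vn'] := leP v (k.+1%:R + n%:R); first exact: IH.
have h1 := IH (k.+1%:R + n%:R).
have h2 : `|pl a v - pl a (k.+1%:R + n%:R)| <= D * (v - (k.+1%:R + n%:R)).
  apply: (local (k.+1 + n)%N); rewrite ?natrD//; first by exact: ltW.
  by rewrite -addnS natrD.
have {}h1 : `|pl a (k.+1%:R + n%:R) - pl a u| <= D * (k.+1%:R + n%:R - u).
  apply: h1; last by [].
  by have : 0 <= n%:R :> R by []; lra.
apply: le_trans (ler_distD (pl a (k.+1%:R + n%:R)) _ _) _.
by move: h1 h2; lra.
Qed.

End PiecewiseLinear.

(** The bound keeps the suprema in the metric finite. Bundling it with the vertices lets the type
    [spiral_space S] determine its metric. *)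
Record spiral (R : realType) (X : metricType R) := Spiral {
  vertex : nat -> X;
  spiral_bound : R;
  spiral_bounded : forall y z : X, mdist y z <= spiral_bound }.

(* The remainder [X] together with the ray [(0, 1]]; the point [s] of the ray
   sits at time [1 / s - 1] on the polygonal path through the vertices. *)
Definition spiral_space (R : realType) (X : metricType R) (S : spiral X) : Type :=
  (X + {s : R | (0 < s <= 1)%R})%type.

(** * The metric of the spiral *)

Section SpiralMetric.
Variables (R : realType) (X : metricType R) (S : spiral X).
Local Notation d := (@mdist R X).
Local Notation Y := (spiral_space S).
Local Notation D := (spiral_bound S).
Implicit Types (y w : Y) (z : option X).

Definition height y : R := match y with inl _ => 0 | inr s => val s end.

Definition time (s : R) : R := s^-1 - 1.

(* The Kuratowski coordinates: distances to the points of [X], interpolated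
   along the ray, together with the height. *)
Definition coord y z : R :=
  match z with
  | None => height y
  | Some x => match y with
    | inl w => d w x
    | inr s => pl (fun k => d (vertex S k) x) (time (val s))
    end
  end.

Lemma time_ge0 (s : R) : 0 < s <= 1 -> 0 <= time s.
Proof.
by move=> /andP[s0 s1]; rewrite /time subr_ge0 invf_ge1.
Qed.

Lemma time_truncn (s : R) : 0 < s <= 1 ->
  (Num.truncn (time s))%:R <= time s <= (Num.truncn (time s)).+1%:R.
Proof. by move=> hs; have /andP[-> /ltW ->] := truncn_itv (time_ge0 hs). Qed.

Lemma height_range y : 0 <= height y <= 1.
Proof.
case: y => [x|[s hs]] /=; first by rewrite lexx ler01.
by have /andP[s0 ->] := hs; rewrite (ltW s0).
Qed.

Lemma coord_bounded y z : `|coord y z| <= D + 1.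
Proof.
have D0 : 0 <= D.
  by apply: le_trans _ (spiral_bounded S (vertex S 0) (vertex S 0)); exact: mdist_ge0.
case: z => [x|] /=; last first.
  by have /andP[h0 h1] := height_range y; rewrite ger0_norm//; lra.
have dD (v : X) : `|d v x| <= D by rewrite ger0_norm ?mdist_ge0//; exact: spiral_bounded.
case: y => [w|[s /= hs]]; first by have := dD w; lra.
have ku := time_truncn hs.
rewrite -[pl _ _]subr0; apply: le_trans (pl_near (e := D) ku _ _) _.
- by rewrite subr0.
- by rewrite subr0.
- by lra.
Qed.

Definition coord_gaps y w : set R := [set `|coord y z - coord w z| | z in [set: option X]].

(** The supremum metric on the coordinates. The height tells points of the ray from each other and
    from the remainder, while distances to points of [X] separate the remainder and reproduce its
    metric. *)
Definition spiral_dist y w : R := sup (coord_gaps y w).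

Lemma coord_gaps_ubound y w : has_ubound (coord_gaps y w).
Proof.
exists ((D + 1) + (D + 1)) => _ [z _ <-].
apply: le_trans (ler_normB _ _) _.
by apply: lerD; exact: coord_bounded.
Qed.

Lemma coord_le_dist y w z : `|coord y z - coord w z| <= spiral_dist y w.
Proof. by apply: ub_le_sup; [exact: coord_gaps_ubound|exists z]. Qed.

Lemma dist_le_coord y w c :
  (forall z, `|coord y z - coord w z| <= c) -> spiral_dist y w <= c.
Proof.
move=> h; apply: ge_sup; first by exists `|coord y None - coord w None|, None.
by move=> _ [z _ <-].
Qed.

Lemma spiral_distxx y : spiral_dist y y = 0.
Proof.
apply/eqP; rewrite eq_le; apply/andP; split.
  by apply: dist_le_coord => z; rewrite subrr normr0.
by apply: le_trans (coord_le_dist y y None).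
Qed.

Lemma spiral_dist_sym y w : spiral_dist y w = spiral_dist w y.
Proof.
by apply/eqP; rewrite eq_le; apply/andP; split; apply: dist_le_coord => z;
  rewrite distrC; exact: coord_le_dist.
Qed.

Lemma spiral_dist_triangle w y v : spiral_dist y v <= spiral_dist y w + spiral_dist w v.
Proof.
apply: dist_le_coord => z; apply: le_trans (ler_distD (coord w z) _ _) _.
by apply: lerD; exact: coord_le_dist.
Qed.

Lemma spiral_dist_eq0 y w : spiral_dist y w = 0 -> y = w.
Proof.
move=> yw; have E z : coord y z = coord w z.
  by apply/eqP; rewrite -subr_eq0 -normr_le0 -yw; exact: coord_le_dist.
case: y w {yw} E => [a|[s hs]] [b|[t ht]] E.
- by have := E (Some b); rewrite /= mdistxx => /mdist_positivity ->.
- by have := E None; rewrite /= => h; exfalso; have := ht; rewrite -h ltxx.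
- by have := E None; rewrite /= => h; exfalso; have := hs; rewrite h ltxx.
- by congr inr; apply: val_inj; exact: E None.
Qed.

HB.instance Definition _ := Choice.on Y.
HB.instance Definition _ := isMetric.Build R Y spiral_distxx spiral_dist_eq0
  spiral_dist_sym spiral_dist_triangle.

Lemma mdist_spiral (y w : Y) : mdist y w = spiral_dist y w.
Proof. by []. Qed.

Definition ray (s : R) : Y :=
  if insub s is Some t then inr t else inl (vertex S 0).

(** A point of the ray goes to the vertex last passed. This is not continuous on the ray, but it
    moves points of small height only a little. *)
Definition to_remainder (y : Y) : X :=
  match y with
  | inl x => x
  | inr s => vertex S (Num.truncn (time (val s)))
  end.

Lemma rayE s (hs : 0 < s <= 1) : ray s = inr (exist _ s hs).
Proof. by rewrite /ray insubT. Qed.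

Lemma height_ray s : 0 < s <= 1 -> height (ray s) = s.
Proof. by move=> hs; rewrite rayE. Qed.

Lemma ray_height y : 0 < height y -> y = ray (height y).
Proof.
case: y => [x|[s hs]] /=; first by rewrite ltxx.
by move=> _; rewrite (rayE hs).
Qed.

Lemma height0 y : height y = 0 -> y = inl (to_remainder y).
Proof.
case: y => [//|[s hs]] /= h.
by exfalso; have := hs; rewrite h ltxx.
Qed.

Lemma height_lipschitz (y w : Y) : `|height y - height w| <= mdist y w.
Proof. exact: (coord_le_dist y w None). Qed.

Lemma mdist_inl (a b : X) : mdist (inl a : Y) (inl b : Y) = d a b.
Proof.
apply/eqP; rewrite eq_le; apply/andP; split.
  apply: dist_le_coord => -[x|] /=; last by rewrite subrr normr0 mdist_ge0.
  rewrite ler_norml; have := metric_triangle a b x; have := metric_triangle b a x.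
  by rewrite (metric_sym b a); lra.
have := coord_le_dist (inl a) (inl b) (Some b).
by rewrite /= mdistxx subr0 ger0_norm ?mdist_ge0.
Qed.

Lemma mdist_ray_inl s k x e : 0 < s <= 1 -> k%:R <= time s <= k.+1%:R ->
  s <= e -> d (vertex S k) x <= e -> d (vertex S k.+1) x <= e ->
  mdist (ray s) (inl x : Y) <= e.
Proof.
move=> hs ks se h1 h2; rewrite mdist_spiral (rayE hs).
apply: dist_le_coord => -[z|] /=; last first.
  by rewrite subr0 gtr0_norm//; have /andP[] := hs.
have dd (v : X) : d v x <= e -> `|d v z - d x z| <= e.
  move=> vx; rewrite ler_norml; have := metric_triangle v x z.
  by have := metric_triangle x v z; rewrite (metric_sym x v); lra.
by apply: (pl_near ks); exact: dd.
Qed.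

(** The height contributes [t - s]; every other coordinate moves at speed at most [D] in the time
    [1 / s - 1]. *)
Lemma mdist_ray_ray s t : 0 < s <= t -> t <= 1 ->
  mdist (ray s) (ray t) <= (t - s) + D * (s^-1 - t^-1).
Proof.
move=> /andP[s0 st] t1.
have t0 : 0 < t by exact: lt_le_trans st.
have hs : 0 < s <= 1 by rewrite s0 (le_trans st).
have ht : 0 < t <= 1 by rewrite t0.
have D0 : 0 <= D.
  by apply: le_trans _ (spiral_bounded S (vertex S 0) (vertex S 0)); exact: mdist_ge0.
have ts : t^-1 <= s^-1 by rewrite lef_pV2.
have D1 : 0 <= D * (s^-1 - t^-1) by apply: mulr_ge0 => //; lra.
rewrite mdist_spiral (rayE hs) (rayE ht); apply: dist_le_coord => -[z|] /=; last first.
  by rewrite distrC ger0_norm; lra.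
have lip k : `|d (vertex S k.+1) z - d (vertex S k) z| <= D.
  rewrite ler_norml; have := spiral_bounded S (vertex S k.+1) (vertex S k).
  have := metric_triangle (vertex S k.+1) (vertex S k) z.
  have := metric_triangle (vertex S k) (vertex S k.+1) z.
  by rewrite (metric_sym (vertex S k) (vertex S k.+1)); lra.
have := @pl_lipschitz R (fun k => d (vertex S k) z) D (time t) (time s) lip (time_ge0 ht).
have -> : time s - time t = s^-1 - t^-1 by rewrite /time; lra.
have tt : time t <= time s by rewrite /time; lra.
by move=> /(_ tt); lra.
Qed.

End SpiralMetric.

Section WithinContinuous.
Variable R : realType.

Lemma within_continuous_mdist (T : topologicalType) (V : metricType R) (A : set T)
    (f : T -> V) :
  (forall x, A x -> forall e, 0 < e -> \forall y \near x, A y -> mdist (f x) (f y) < e) ->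
  {within A, continuous f}.
Proof.
move=> h; apply/subspace_continuousP => x Ax.
by apply/metricType_numDomainType.cvgrPdist_lt => e e0; exact: h.
Qed.

Lemma within_continuous_real (T : metricType R) (A : set T) (f : T -> R) :
  (forall x y, `|f x - f y| <= mdist x y) -> {within A, continuous f}.
Proof.
move=> h; apply/subspace_continuousP => x Ax.
apply/cvgrPdist_lt => e e0; rewrite near_withinE; apply/near_mdistP.
by exists e => // y xy _; exact: le_lt_trans (h x y) xy.
Qed.

End WithinContinuous.

(** * Topology of the spiral *)

Section SpiralTopology.
Variables (R : realType) (X : metricType R).
Hypothesis cX : compact [set: X].
Hypothesis conX : connected [set: X].
Variables (S : spiral X) (eta : nat -> R).
Local Notation d := (@mdist R X).
Local Notation Y := (spiral_space S).
Local Notation x := (vertex S).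
Local Notation h := (@height R X S).
Implicit Types (A B : set X) (K L M : set Y).
Hypothesis etaP : forall e : R, 0 < e -> exists N, forall n, (N <= n)%N -> eta n <= e.
Hypothesis denseP : forall (e : R) N y, 0 < e -> exists2 k, (N <= k)%N & d (x k) y < e.
Hypothesis traceP : forall p q, (p <= q)%N -> exists A, [/\ subcontinuum A,
   hclose (eta p) A (nseg x p q) &
   forall A', subcontinuum A' -> A `<=` A' -> exists p' q',
     [/\ (p' <= p)%N, (q <= q')%N, hclose (eta p) A' (nseg x p' q'),
      forall k, (p' <= k)%N -> d (x k) (x k.+1) <= eta p &
      forall k, (p' <= k)%N -> k.+1%:R^-1 <= eta p]].

Lemma vertex_step p k : (p <= k)%N ->
  d (x k) (x k.+1) <= eta p /\ k.+1%:R^-1 <= eta p.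
Proof.
move=> pk; have [A [sA _ h]] := traceP (leqnn p).
have [//|p' [q' [p'p _ _ h1 h2]]] := h A sA.
by split; [apply: h1|apply: h2]; exact: leq_trans pk.
Qed.

Lemma time_inv k : time (k.+1%:R^-1 : R) = k%:R.
Proof. by rewrite /time invrK -natr1 addrK. Qed.

Lemma inv_unit k : 0 < (k.+1%:R^-1 : R) <= 1.
Proof. by rewrite invr_gt0 ltr0n invf_le1 ?ltr0n// ler1n. Qed.

Lemma time_ge (s : R) k : 0 < s <= 1 -> (k%:R <= time s) = (s <= k.+1%:R^-1).
Proof.
move=> /andP[s0 _]; rewrite /time lerBrDr natr1 -[leRHS]invrK.
rewrite -[in RHS](invrK s) lef_pV2 ?posrE ?invr_gt0 ?invrK//.
Qed.

Lemma time_le (s : R) k : 0 < s <= 1 -> (time s <= k%:R) = (k.+1%:R^-1 <= s).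
Proof.
move=> /andP[s0 _]; rewrite /time lerBlDr natr1 -[in RHS](invrK s).
by rewrite lef_pV2 ?posrE ?invr_gt0.
Qed.

Lemma mdist_ray_vertex p s k c : 0 < s <= 1 -> k%:R <= time s <= k.+1%:R ->
  (forall k, (p <= k)%N -> d (x k) (x k.+1) <= c /\ k.+1%:R^-1 <= c) -> (p <= k)%N ->
  mdist (ray S s) (inl (x k) : Y) <= c /\ mdist (ray S s) (inl (x k.+1) : Y) <= c.
Proof.
move=> hs ks st pk; have [h1 h2] := st k pk.
have c0 : 0 <= c by apply: le_trans h1; exact: mdist_ge0.
have sc : s <= c.
  by apply: le_trans h2; rewrite -time_ge//; have /andP[] := ks.
split; apply: (mdist_ray_inl hs ks) => //; rewrite ?mdistxx//.
by rewrite metric_sym.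
Qed.

Lemma ray_time (p : nat) (s : R) : 0 < s <= 1 -> s < p.+1%:R^-1 -> (p <= Num.truncn (time s))%N.
Proof.
by move=> hs sp; rewrite truncn_ge_nat ?time_ge0// time_ge// ltW.
Qed.

Lemma near_remainder e : 0 < e ->
  exists2 r, 0 < r & forall y : Y, h y < r -> mdist y (inl (to_remainder y) : Y) <= e.
Proof.
move=> e0; have [N hN] := etaP e0; exists N.+1%:R^-1; first by have /andP[] := inv_unit N.
case=> [a|[s hs]] /= yN; first by rewrite mdistxx ltW.
have [h1 _] := mdist_ray_vertex hs (time_truncn hs) (@vertex_step N) (ray_time hs yN).
by rewrite -(rayE S hs); apply: le_trans h1 (hN _ _).
Qed.

Lemma height_continuous M : {within M, continuous h}.
Proof. by apply: within_continuous_real => y w; exact: height_lipschitz. Qed.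

Lemma inl_continuous A : {within A, continuous (inl : X -> Y)}.
Proof.
apply: within_continuous_mdist => a _ e e0; apply/near_mdistP; exists e => // b ab _.
by rewrite mdist_inl.
Qed.

Lemma to_remainder_continuous :
  {within [set y : Y | h y = 0], continuous (@to_remainder R X S)}.
Proof.
apply: within_continuous_mdist => y hy e e0; apply/near_mdistP; exists e => // w yw hw.
by rewrite -(mdist_inl S) -(height0 hy) -(height0 hw).
Qed.

Lemma ray_continuous : {within `]0, 1]%classic, continuous (ray S)}.
Proof.
apply: within_continuous_mdist => s; rewrite /= in_itv/= => hs e e0.
have D0 : 0 <= spiral_bound S.
  by apply: le_trans _ (spiral_bounded S (x 0) (x 0)); exact: mdist_ge0.
(* Makes [spiral_bound S * c] at most [e / 2]; adding 1 avoids division by zero. *)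
pose c := e / (2 * (spiral_bound S + 1)).
have c0 : 0 < c by apply: divr_gt0; lra.
have cE : spiral_bound S * c <= e / 2.
  by rewrite /c mulrA ler_pdivrMr; [nra|lra].
have s0 : s != 0 by have /andP[] := hs; lra.
have n1 : \forall t \near s, `|s^-1 - t^-1| < c.
  by have /cvgrPdist_lt := inv_continuous s0; apply.
have n2 : \forall t \near s, `|s - t| < e / 2.
  by apply: (@cvgr_dist_lt _ _ _ (nbhs s) _ id s) => //; lra.
have main t u : 0 < t <= u -> u <= 1 -> `|t^-1 - u^-1| < c -> `|t - u| < e / 2 ->
    mdist (ray S t) (ray S u) < e.
  move=> ht hu h1 h2; apply: le_lt_trans (mdist_ray_ray S ht hu) _.
  have := ler_norm (u - t); rewrite distrC => h3.
  have h4 : spiral_bound S * (t^-1 - u^-1) <= spiral_bound S * c.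
    by apply: ler_wpM2l => //; apply: le_trans (ler_norm _) (ltW h1).
  lra.
apply: filterS2 n1 n2 => t h1 h2; rewrite /= in_itv/= => ht.
have [st|ts] := leP s t.
  by apply: main => //; rewrite ?st; have /andP[] := hs; have /andP[] := ht => *; lra.
rewrite metric_sym; apply: main; rewrite ?(distrC t)//?(distrC t^-1)//.
  by rewrite (ltW ts) andbT; have /andP[] := ht.
by have /andP[] := hs.
Qed.

(** * Slices, compactness and the subcontinua meeting the ray *)

Definition slice (a b : R) : set Y := [set y | a <= h y <= b].

Lemma slice_closed a b : closed (slice a b).
Proof.
move=> y /closure_mdistP cy; apply/andP; split; apply/ler_addgt0Pl => e e0;
  have [w /andP[aw wb] yw] := cy e e0; have := height_lipschitz y w;
  rewrite ler_norml; lra.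
Qed.

Lemma slice_ray_compact a b : 0 < a -> b <= 1 -> compact (slice a b).
Proof.
move=> a0 b1; have -> : slice a b = ray S @` `[a, b]%classic.
  apply/seteqP; split=> [y /andP[ay yb]|_ [s + <-]].
    exists (h y); first by rewrite /= in_itv/= ay.
    by rewrite -ray_height//; exact: lt_le_trans ay.
  rewrite /= in_itv/= => /andP[as_ sb]; rewrite /slice/= height_ray ?as_//.
  by rewrite (lt_le_trans a0 as_) (le_trans sb).
apply: continuous_compact; last exact: segment_compact.
apply: continuous_subspaceW ray_continuous => s /=; rewrite !in_itv/= => /andP[h1 h2].
by apply/andP; split; lra.
Qed.

(** An ultrafilter either contains a slice bounded away from the remainder, which is a compact arc,
    or its heights tend to 0. In the latter case its image under [to_remainder] clusters in [X], and
    so does the ultrafilter. *)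
Lemma spiral_compact : compact [set: Y].
Proof.
rewrite compact_ultra => F FU _.
suff [y cy] : exists y, cluster F y.
  by exists y; split=> //=; rewrite -[_ --> _]/([set p | F --> p] y) -ultra_cvg_clusterE.
have [[r [r0 Fr]]|noF] := pselect (exists r, 0 < r /\ F (slice r 1)).
  have [y [_ cy]] := slice_ray_compact r0 (lexx 1) _ Fr.
  by exists y.
have Flow r : 0 < r -> F [set y | h y < r].
  move=> r0; have [//|Fr] := in_ultra_setVsetC [set y | h y < r] FU.
  exfalso; apply: noF; exists r; split=> //; apply: filterS Fr => y /= /negP.
  by rewrite -leNgt /slice/= => ->; have /andP[] := height_range y.
have [|z [_ cz]] := cX (F := @to_remainder R X S @ F).
  exact: filterT.
exists (inl z) => A B FA /near_mdistP[r r0 rB].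
have r20 : 0 < r / 2 by lra.
have [s s0 hs] := near_remainder (divr_gt0 r20 (ltr0n _ 2)).
have FG : F (A `&` [set y | h y < s]) by apply: filterI => //; exact: Flow.
have [||w [[y [Ay ys] <-] zy]] :=
  cz (@to_remainder R X S @` (A `&` [set y | h y < s])) [set w | d z w < r / 2].
- exact: (@filterS _ F _ _ _ (fun y Cy => ex_intro2 _ _ y Cy erefl) FG).
- by apply/near_mdistP; exists (r / 2).
exists y; split=> //; apply: rB.
have := hs y ys; rewrite metric_sym => h1.
have := metric_triangle (inl z : Y) (inl (to_remainder y)) y.
by rewrite mdist_inl; move: zy => /=; lra.
Qed.

Lemma slice_compact a b : compact (slice a b).
Proof. exact: (subclosed_compact (@slice_closed a b) spiral_compact). Qed.

Lemma remainder_closure_ray b (z : X) : 0 < b -> b <= 1 ->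
  closure (ray S @` [set s | 0 < s <= b]) (inl z).
Proof.
move=> b0 b1; apply/closure_mdistP => r r0.
have r20 : 0 < r / 2 by lra.
have [N hN] := etaP r20.
have [M hM] : exists M : nat, b^-1 < M%:R.
  by exists (Num.bound b^-1); apply: archi_boundP; rewrite invr_ge0 ltW.
have [k Nk kz] := denseP (maxn N M) z r20.
have hk := inv_unit k.
exists (ray S k.+1%:R^-1).
  exists k.+1%:R^-1 => //=; have /andP[-> _] := hk => /=.
  rewrite -[leRHS]invrK lef_pV2 ?posrE ?invr_gt0 ?ltr0n//.
  by apply: le_trans (ltW hM) _; rewrite ler_nat; lia.
have [|||h1 _] := @mdist_ray_vertex (maxn N M) k.+1%:R^-1 k (r / 2) hk.
- by rewrite time_inv lexx ler_nat/= leqnSn.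
- move=> j hj; have [|s1 s2] := @vertex_step N j; first by lia.
  by split; [exact: le_trans s1 (hN _ _)|exact: le_trans s2 (hN _ _)].
- exact: Nk.
have := metric_triangle (inl z : Y) (inl (x k)) (ray S k.+1%:R^-1).
rewrite mdist_inl (metric_sym z) (metric_sym (inl (x k) : Y)).
by lra.
Qed.

(** A slice is the closure of an arc or half-open arc of the ray; for [a = 0] density of the
    vertices adds the whole remainder. Connectedness of slices, and their inclusion in closed sets,
    follow from this. *)
Lemma sliceE a b : 0 <= a -> a <= b -> 0 < b -> b <= 1 ->
  slice a b = closure (ray S @` [set s | a <= s <= b /\ 0 < s]).
Proof.
move=> a0 ab b0 b1; apply/seteqP; split=> [y /andP[ay yb]|]; last first.
  rewrite [X in _ `<=` X](closure_id _).1; last exact: slice_closed.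
  apply: closureS => _ [s /= [hs s0] <-]; rewrite /slice/= height_ray//.
  by apply/andP; split; lra.
have [hy|hy] := ltP 0 (h y).
  apply: subset_closure; exists (h y); last by rewrite -ray_height.
  by split=> //; rewrite ay.
have hy0 : h y = 0 by have /andP[] := height_range y; lra.
rewrite (height0 hy0); move: (@remainder_closure_ray b (to_remainder y) b0 b1).
apply: closureS.
move=> _ [s /= hs <-]; exists s => //=; split; last by have /andP[] := hs.
by have /andP[] := hs; move=> *; apply/andP; split; lra.
Qed.

Lemma slice_connected a b : 0 <= a -> a <= b -> 0 < b -> b <= 1 -> connected (slice a b).
Proof.
move=> a0 ab b0 b1; rewrite sliceE//; apply: connected_closure.
apply: connected_continuous_connected.
  apply/connected_intervalP => s t /= [hs s0] [ht t0] u /andP[su ut].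
  by move: hs ht => /andP[] ? ? /andP[] ? ?; split; [apply/andP; split|]; lra.
apply: continuous_subspaceW ray_continuous => s /= [/andP[h1 h2] h3].
by rewrite in_itv/= h3 (le_trans h2).
Qed.

Lemma slice_nonempty a b : 0 <= a -> a <= b -> 0 < b -> b <= 1 -> slice a b (ray S b).
Proof. by move=> a0 ab b0 b1; rewrite /slice/= height_ray ?b0// lexx ab. Qed.

Lemma slice_subcontinuum a b : 0 <= a -> a <= b -> 0 < b -> b <= 1 ->
  subcontinuum (slice a b).
Proof.
move=> a0 ab b0 b1; split.
- by exists (ray S b); exact: slice_nonempty.
- exact: slice_compact.
- exact: slice_connected.
Qed.

Lemma height_extrema M : subcontinuum M -> exists y w,
  [/\ M y, M w & forall v, M v -> h y <= h v <= h w].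
Proof.
move=> [M0 cM _].
have [y My ymin] := compact_EVT_min M0 cM (@height_continuous M).
have [w Mw wmax] := compact_EVT_max M0 cM (@height_continuous M).
rewrite !inE in My Mw; exists y, w; split=> // v Mv.
by rewrite ymin ?wmax// inE.
Qed.

(** The heights on [M] form an interval, and a positive height determines the point; the remaining
    points come from closedness. *)
Lemma subcontinuum_slice M y : subcontinuum M -> M y -> 0 < h y ->
  exists a b, [/\ 0 <= a, a <= b, 0 < b, b <= 1 & M = slice a b].
Proof.
move=> sM My hy; have [w1 [w2 [M1 M2 ext]]] := height_extrema sM.
have [_ cM conM] := sM.
have /andP[a0 _] := height_range w1; have /andP[_ b1] := height_range w2.
have ab : h w1 <= h w2 by have /andP[] := ext _ M2.
have b0 : 0 < h w2 by apply: lt_le_trans hy _; have /andP[] := ext _ My.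
exists (h w1), (h w2); split=> //; apply/seteqP; split; first by move=> v /ext.
have clM := compact_subset_closed cM.
rewrite sliceE// [X in _ `<=` X](closure_id _).1//.
apply: closureS => _ [s /= [hs s0] <-].
have I := (connected_intervalP (h @` M)).1
  (connected_continuous_connected conM (@height_continuous M)) (h w1) (h w2).
have [v Mv vs] : (h @` M) s by apply: I.
by rewrite -vs -ray_height// vs.
Qed.

Lemma spiral_connected : connected [set: Y].
Proof.
have -> : [set: Y] = slice 0 1.
  by apply/seteqP; split=> y // _; exact: height_range.
by apply: slice_connected; lra.
Qed.

Lemma spiral_compactification : (exists a b : X, a <> b) ->
  compactification_with_remainder [set y : Y | 0 < h y] [set y : Y | h y = 0].
Proof.
move=> [a [b ab]]; split.
- split; [exact: spiral_compact|exact: spiral_connected|].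
  by exists (inl a), (inl b) => -[].
- exists (ray S), h; split.
  + split.
    * by move=> s /=; rewrite in_itv/= => hs; rewrite height_ray//; have /andP[] := hs.
    * move=> s t; rewrite !inE/= !in_itv/= => hs ht.
      by move=> /(congr1 h); rewrite !height_ray.
    * move=> y /= hy; exists (h y); last by rewrite -ray_height.
      by rewrite /= in_itv/= hy; have /andP[] := height_range y.
  + by move=> s; rewrite inE/= in_itv/= => hs; rewrite height_ray.
  + exact: ray_continuous.
  + exact: height_continuous.
- move=> O [y Oy] oO.
  have [hy|hy] := ltP 0 (h y); first by exists y.
  have hy0 : h y = 0 by have /andP[] := height_range y; lra.
  have := @remainder_closure_ray 1 (to_remainder y) ltr01 (lexx 1).
  have nO : nbhs y O by exact: open_nbhs_nbhs.
  rewrite -(height0 hy0) => /(_ O nO)[_ [[s /= hs <-] Os]]; exists (ray S s); split=> //=.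
  by rewrite height_ray//; have /andP[] := hs.
- apply/seteqP; split=> // y _; have [hy|hy] := ltP 0 (h y); [by left|right].
  by have /andP[] := height_range y; rewrite /=; lra.
- by rewrite -subset0 => y /= [hy h0]; rewrite h0 ltxx in hy.
Qed.

Lemma remainder_homeomorphic : homeomorphic_sets [set: X] [set y : Y | h y = 0].
Proof.
exists inl, (@to_remainder R X S); split.
- split; first by [].
  + by move=> a b _ _ [].
  + by move=> y /= /height0 ->; exists (to_remainder y).
- by [].
- exact: inl_continuous.
- exact: to_remainder_continuous.
Qed.

Lemma inl_preimageK K : (forall y, K y -> h y = 0) ->
  inl @` ((inl : X -> Y) @^-1` K) = K.
Proof.
move=> K0; apply/seteqP; split=> [_ [a /= Ka <-]//|y Ky].
by exists (@to_remainder R X S y); rewrite /= -height0//; exact: K0.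
Qed.

Lemma remainder_subcontinuum K : subcontinuum K -> (forall y, K y -> h y = 0) ->
  subcontinuum ((inl : X -> Y) @^-1` K).
Proof.
move=> [[y Ky] cK conK] K0; split.
- by exists (@to_remainder R X S y); rewrite /= -height0//; exact: K0.
- apply: (subclosed_compact _ cX) => // a /closure_mdistP ca /=.
  apply: (compact_subset_closed cK); apply/closure_mdistP => r r0.
  by have [b Kb ab] := ca r r0; exists (inl b) => //; rewrite mdist_inl.
- have -> : (inl : X -> Y) @^-1` K = @to_remainder R X S @` K.
    apply/seteqP; split=> [a Ka|_ [w Kw <-]]; first by exists (inl a).
    by rewrite /= -height0//; exact: K0.
  apply: connected_continuous_connected => //.
  by apply: continuous_subspaceW to_remainder_continuous.
Qed.

Lemma inl_subcontinuum A : subcontinuum A -> subcontinuum ((inl : X -> Y) @` A).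
Proof.
move=> [[a Aa] cA conA]; split.
- by exists (inl a), a.
- by apply: continuous_compact => //; exact: inl_continuous.
- by apply: connected_continuous_connected => //; exact: inl_continuous.
Qed.

(** * Comparing the ray with the remainder *)

Lemma hclose_inl e A B :
  hclose e ((inl : X -> Y) @` A) ((inl : X -> Y) @` B) <-> hclose e A B.
Proof.
split=> [[h1 h2]|[h1 h2]]; split.
- move=> a Aa; have [|_ [b Bb <-]] := h1 (inl a); first by exists a.
  by rewrite mdist_inl; exists b.
- move=> b Bb; have [|_ [a Aa <-]] := h2 (inl b); first by exists b.
  by rewrite mdist_inl; exists a.
- by move=> _ [a /h1[b Bb ab] <-]; exists (inl b); [exists b|rewrite mdist_inl].
- by move=> _ [b /h2[a Aa ab] <-]; exists (inl a); [exists a|rewrite mdist_inl].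
Qed.

Lemma hclose_height e K M y a b : hclose e K M -> (forall w, M w -> a <= h w <= b) ->
  K y -> a - e <= h y <= b + e.
Proof.
move=> [h1 _] Mab /h1[w /Mab wab yw]; have := height_lipschitz y w.
by rewrite ler_norml; lra.
Qed.

(** Time decreases with height, so the slice starts at [b]. Points of the slice are matched with the
    vertex last passed, and vertices with their own positions on the ray; only [p] and [q] may fall
    outside the slice, and are then matched with its end points. *)
Lemma nseg_slice_close p q a b c : 0 < a -> a <= b -> b <= 1 ->
  p%:R <= time b <= p.+1%:R -> time a <= q%:R <= time a + 1 ->
  (forall k, (p <= k)%N -> d (x k) (x k.+1) <= c /\ k.+1%:R^-1 <= c) ->
  hclose c ((inl : X -> Y) @` nseg x p q) (slice a b).
Proof.
move=> a0 ab b1 /andP[pb bp] /andP[aq qa] st.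
have ha : 0 < a <= 1 by rewrite a0 (le_trans ab).
have hb : 0 < b <= 1 by rewrite (lt_le_trans a0).
have ba s : 0 < s -> s <= b -> time b <= time s.
  by move=> s0 sb; rewrite /time lerD2r lef_pV2 ?posrE//; have /andP[] := hb.
split.
  move=> _ [_ [k /andP[pk kq] ->] <-].
  have hk := inv_unit k.
  have [kb|bk] := leP (k.+1%:R^-1) b; last first.
    have kE : k = p.
      apply/eqP; rewrite eqn_leq pk andbT -ltnS -(ltr_nat R).
      by apply: lt_le_trans bp; rewrite ltNge time_le// -ltNge.
    exists (ray S b); first by apply: slice_nonempty; lra.
    rewrite metric_sym kE; have [] := @mdist_ray_vertex p b p c hb _ st (leqnn p).
      by rewrite pb.
    by [].
  have [ak|ka] := leP a (k.+1%:R^-1).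
    exists (ray S k.+1%:R^-1); first by rewrite /slice/= height_ray// ak.
    rewrite metric_sym; have [] := @mdist_ray_vertex p _ k c hk _ st pk.
      by rewrite time_inv lexx ler_nat/= leqnSn.
    by [].
  have ak : time a < k%:R by rewrite ltNge time_ge// -ltNge.
  have pk' : (p < k)%N.
    by rewrite -(ltr_nat R); apply: le_lt_trans pb _; apply: le_lt_trans (ba a _ _) ak.
  have kE : k = q.
    apply/eqP; rewrite eqn_leq kq/= -ltnS -(ltr_nat R) -natr1.
    by apply: le_lt_trans qa _; rewrite ltrD2r.
  case: k pk kq hk kb ka ak pk' kE => [//|j] pk kq hk kb ka ak pj kE.
  exists (ray S a).
    by rewrite /slice/= height_ray// lexx.
  rewrite metric_sym; have [] := @mdist_ray_vertex p a j c ha _ st _ => //.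
  rewrite (ltW ak) andbT.
  by move: qa; rewrite -kE -natr1 lerD2r.
move=> y /andP[ay yb]; have y0 : 0 < h y by exact: lt_le_trans ay.
have hy : 0 < h y <= 1 by rewrite y0; have /andP[] := height_range y.
pose k := Num.truncn (time (h y)).
have ks : k%:R <= time (h y) <= k.+1%:R by exact: time_truncn.
have pk : (p <= k)%N.
  by rewrite truncn_ge_nat ?time_ge0//; apply: le_trans pb _; exact: ba.
have kq : (k <= q)%N.
  rewrite -(ler_nat R); have /andP[k1 _] := ks; apply: le_trans k1 _.
  by apply: le_trans aq; rewrite /time lerD2r lef_pV2 ?posrE.
exists (inl (x k)); first by exists (x k) => //; exists k => //; rewrite pk.
rewrite metric_sym [y]ray_height//.
by have [] := @mdist_ray_vertex p (h y) k c hy ks st pk.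
Qed.

Lemma height_modulus : exists delta : R -> R, forall e, 0 < e ->
  [/\ 0 < delta e,
   forall y : Y, h y < delta e -> mdist y (inl (to_remainder y) : Y) <= e &
   forall (p : nat) b, 0 < b <= 1 -> b < delta e -> p%:R <= time b <= p.+1%:R ->
     2 * eta p <= e].
Proof.
have ex e : exists r, 0 < e -> [/\ 0 < r,
   forall y : Y, h y < r -> mdist y (inl (to_remainder y) : Y) <= e &
   forall (p : nat) b, 0 < b <= 1 -> b < r -> p%:R <= time b <= p.+1%:R ->
     2 * eta p <= e].
  have [e0|e0] := ltP 0 e; last by exists 0; lra.
  have [r r0 hr] := near_remainder e0.
  have e20 : 0 < e / 2 by lra.
  have [N hN] := etaP e20.
  (* At heights below [N.+2%:R^-1] the time is at least [N.+1], so the vertex last passed has index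
     at least [N]. *)
  exists (Num.min r N.+2%:R^-1) => _; split.
  - by rewrite lt_min r0; have /andP[] := inv_unit N.+1.
  - by move=> y; rewrite lt_min => /andP[yr _]; exact: hr.
  - move=> p b hb; rewrite lt_min => /andP[_ bN] /andP[_ bp].
    have Np : (N <= p)%N.
      rewrite leqNgt; apply/negP => pN; move: bp; apply/negP; rewrite -ltNge.
      have h1 : p.+1%:R < (N.+1%:R : R) by rewrite ltr_nat ltnS.
      by apply: lt_le_trans h1 _; rewrite time_ge// ltW.
    by have := hN p Np; lra.
have [delta dP] := choice ex; exists delta => e e0.
by have [h1 h2 h3] := dP e e0.
Qed.

(* The set [A] stands in for [M] in the remainder: maximality of a limit of the
   [M]'s passes to the [A]'s, since every extension of [A] lifts back. *)
Lemma shadow (delta : R -> R) M :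
  (forall e, 0 < e ->
  [/\ 0 < delta e,
   forall y : Y, h y < delta e -> mdist y (inl (to_remainder y) : Y) <= e &
   forall (p : nat) b, 0 < b <= 1 -> b < delta e -> p%:R <= time b <= p.+1%:R ->
     2 * eta p <= e]) ->
  subcontinuum M -> exists A, [/\ subcontinuum A,
    forall e, 0 < e -> (forall y, M y -> h y < delta e) ->
      hclose e ((inl : X -> Y) @` A) M &
    forall A', subcontinuum A' -> A `<=` A' -> exists M',
      [/\ subcontinuum M', M `<=` M' &
       forall e, 0 < e -> (forall y, M y -> h y < delta e) ->
         hclose e ((inl : X -> Y) @` A') M']].
Proof.
move=> deltaP sM.
have [[y [My hy]]|flat] := pselect (exists y, M y /\ 0 < h y); last first.
  have M0 y : M y -> h y = 0.
    move=> My; have /andP[h1 _] := height_range y.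
    apply/eqP; rewrite eq_le h1 andbT leNgt; apply/negP => hy.
    by apply: flat; exists y.
  exists (inl @^-1` M); split; first exact: remainder_subcontinuum.
    by move=> e e0 _; rewrite inl_preimageK//; apply: hclose_refl; exact: ltW.
  move=> A' sA' MA'; exists (inl @` A'); split; first exact: inl_subcontinuum.
    by rewrite -[X in X `<=` _]inl_preimageK//; exact: image_subset.
  by move=> e e0 _; apply: hclose_refl; exact: ltW.
have [a [b [a0 ab b0 b1 ME]]] := subcontinuum_slice sM My hy.
have Mb : M (ray S b) by rewrite ME; exact: slice_nonempty.
have hb : 0 < b <= 1 by rewrite b0.
(* [M] contains the whole remainder: [X] itself is the shadow, and it has no proper enlargement. *)
have [aE|a_neq0] := eqVneq a 0.
  have XM e : 0 < e -> (forall y, M y -> h y < delta e) ->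
      hclose e ((inl : X -> Y) @` [set: X]) M.
    move=> e0 small; have [_ hd _] := deltaP e e0; split.
      move=> _ [z _ <-]; exists (inl z); last by rewrite mdistxx ltW.
      by rewrite ME /slice/= aE lexx ltW.
    move=> w Mw; exists (inl (to_remainder w)); first by exists (to_remainder w).
    by rewrite metric_sym; apply: hd; exact: small.
  exists [set: X]; split=> //; first by split=> //; exists (to_remainder y).
  move=> A' _ TA'; exists M; split=> //; have -> : A' = [set: X]; last by [].
  by apply/seteqP; split=> // z _; exact: TA'.
have a_gt0 : 0 < a by lra.
have ha : 0 < a <= 1 by rewrite a_gt0 (le_trans ab).
pose p := Num.truncn (time b); pose q := (Num.truncn (time a)).+1.
have /andP[pb bp] : p%:R <= time b <= p.+1%:R by exact: time_truncn.
have /andP[qa aq] := time_truncn ha.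
have timeab : time b <= time a.
  by rewrite /time lerD2r lef_pV2.
have pq : (p <= q)%N.
  by rewrite -(ler_nat R); apply: le_trans pb _; apply: le_trans timeab aq.
have [A [sA Aclose Aext]] := traceP pq.
have etae e : 0 < e -> (forall y, M y -> h y < delta e) -> 2 * eta p <= e.
  move=> e0 small; have [_ _ hd] := deltaP e e0; apply: (hd p b) => //.
    by have := small _ Mb; rewrite height_ray.
  by rewrite pb.
exists A; split=> //.
  move=> e e0 small; apply: hclose_le (etae e e0 small) _.
  have -> : 2 * eta p = eta p + eta p by lra.
  apply: (@hclose_trans _ _ _ _ _ ((inl : X -> Y) @` nseg x p q)); first by apply/hclose_inl.
  rewrite ME; apply: nseg_slice_close => //; first by rewrite pb.
    by rewrite aq/= /q -natr1 lerD2r.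
  exact: vertex_step.
move=> A' sA' AA'; have [p' [q' [p'p qq' cl st1 st2]]] := Aext A' sA' AA'.
have hp' := inv_unit p'; have hq' := inv_unit q'.
have p'q' : (p' <= q')%N by exact: leq_trans p'p (leq_trans pq qq').
have qp' : q'.+1%:R^-1 <= p'.+1%:R^-1 :> R.
  by rewrite lef_pV2 ?posrE ?ltr0n// ler_nat.
(* The arc of the ray from vertex [p'] to vertex [q'], which contains [M] because [p' <= p] and
   [q <= q']. *)
exists (slice q'.+1%:R^-1 p'.+1%:R^-1); split.
- by have /andP[? ?] := hp'; have /andP[? ?] := hq'; apply: slice_subcontinuum => //; exact: ltW.
- rewrite ME => w /andP[aw wb]; apply/andP; split.
    apply: le_trans aw; rewrite -time_le//; apply: le_trans aq _.
    by rewrite ler_nat.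
  apply: le_trans wb _; rewrite -time_ge//; apply: le_trans pb.
  by rewrite ler_nat.
- move=> e e0 small; apply: hclose_le (etae e e0 small) _.
  have -> : 2 * eta p = eta p + eta p by lra.
  apply: (@hclose_trans _ _ _ _ _ ((inl : X -> Y) @` nseg x p' q')); first by apply/hclose_inl.
  apply: nseg_slice_close => //.
  + by have /andP[] := hp'.
  + by rewrite time_inv lexx ler_nat/= leqnSn.
  + by rewrite time_inv lexx/= lerDl.
  + by move=> k pk; split; [exact: st1|exact: st2].
Qed.

(** Each approximating [M_ n] is enlarged to the least slice containing it and [K], the slice from
    [a] to [b]. Heights on [M_ n] tend into [[a, b]], so these slices converge to [K], and
    maximality gives [M = K]. *)
Lemma slice_maximal_limit a b M : 0 <= a -> a <= b -> 0 < b -> b <= 1 ->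
  maximal_limit_continuum (slice a b) M -> M = slice a b.
Proof.
move=> a0 ab b0 b1 [sM MK [M_ [sM_ cvM maxM]]].
have hb : 0 < b <= 1 by rewrite b0.
have /choice[yw ywP] n : exists yw : Y * Y,
    [/\ M_ n yw.1, M_ n yw.2 & forall v, M_ n v -> h yw.1 <= h v <= h yw.2].
  by have [y [w h1]] := height_extrema (sM_ n); exists (y, w).
pose lo n := Num.min a (h (yw n).1); pose hi n := Num.max b (h (yw n).2).
have lo0 n : 0 <= lo n by rewrite le_min a0; have /andP[] := height_range (yw n).1.
have lohi n : lo n <= hi n by rewrite ge_min le_max ab.
have hi0 n : 0 < hi n by rewrite lt_max b0.
have hi1 n : hi n <= 1 by rewrite ge_max b1; have /andP[] := height_range (yw n).2.
apply/esym; apply: (maxM (fun n => slice (lo n) (hi n))) => //.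
- by move=> n; exact: slice_subcontinuum.
- exact: slice_subcontinuum.
- move=> n y /(let: And3 _ _ h := ywP n in h) /andP[h1 h2].
  by apply/andP; split; rewrite ?ge_min ?le_max ?h1 ?h2 orbT.
apply/hausdorff_cvgP => e e0.
have near_ray s : 0 < s <= 1 -> exists2 r, 0 < r &
    forall t, 0 < t <= 1 -> `|s - t| < r -> mdist (ray S s) (ray S t) < e.
  move=> hs; have /subspace_continuousP/(_ s) := ray_continuous.
  rewrite /= in_itv/= => /(_ hs)/metricType_numDomainType.cvgrPdist_lt/(_ e e0).
  rewrite near_withinE => /nbhs_ballP[r /= r0 hr]; exists r => // t ht st.
  by apply: hr; rewrite ?in_itv.
have [rb rb0 hrb] := near_ray b hb.
have [ra ra0 hra] : exists2 r, 0 < r & forall t, 0 < t <= 1 -> 0 < a -> `|a - t| < r ->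
    mdist (ray S a) (ray S t) < e.
  have [a_gt0|a_le0] := ltP 0 a; last by exists 1 => // t _; rewrite ltNge a_le0.
  have [|r r0 hr] := near_ray a; first by rewrite a_gt0 (le_trans ab).
  by exists r => // t ht _; exact: hr.
(* For positive [a], [r < a] keeps the enlarged slices on the ray; halving makes all the bounds
   strict. *)
pose r := Num.min (Num.min ra rb) (if 0 < a then a else 1) / 2.
have [r0 rra rrb ara] : [/\ 0 < r, r < ra, r < rb & 0 < a -> r < a].
  have m0 : 0 < Num.min (Num.min ra rb) (if 0 < a then a else 1).
    by rewrite !lt_min ra0 rb0/=; case: ifP.
  have m1 : Num.min (Num.min ra rb) (if 0 < a then a else 1) <= ra.
    by rewrite !ge_min lexx.
  have m2 : Num.min (Num.min ra rb) (if 0 < a then a else 1) <= rb.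
    by rewrite !ge_min lexx orbT.
  have m3 : 0 < a -> Num.min (Num.min ra rb) (if 0 < a then a else 1) <= a.
    by move=> ->; rewrite !ge_min lexx !orbT.
  by rewrite /r; split; [lra|lra|lra|move=> /m3; lra].
have [N _ hN] := (hausdorff_cvgP M_ M).1 cvM r r0.
exists N => // n /hN clM.
have bounds w : M_ n w -> a - r <= h w <= b + r.
  by apply: hclose_height clM _ => v /MK.
have [y1 y2 _] := ywP n.
have /andP[lo_ge _] := bounds _ y1; have /andP[_ hi_le] := bounds _ y2.
have log : a - r <= lo n by rewrite le_min lo_ge andbT; lra.
have hil : hi n <= b + r by rewrite ge_max hi_le andbT; lra.
split; last first.
  move=> w /andP[h1 h2]; exists w; last by rewrite mdistxx ltW.
  by apply/andP; split; [apply: le_trans h1; rewrite ge_min lexx|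
    apply: le_trans h2 _; rewrite le_max lexx].
move=> w /andP[h1 h2].
have [wa|aw] := ltP (h w) a.
  have a_gt0 : 0 < a by have /andP[] := height_range w; lra.
  have hw0 : 0 < h w by have := ara a_gt0; lra.
  exists (ray S a).
    by rewrite /slice/= height_ray ?lexx// a_gt0 (le_trans ab).
  rewrite [w]ray_height// metric_sym; apply: ltW; apply: hra => //.
    by rewrite hw0; have /andP[] := height_range w.
  by rewrite ger0_norm; lra.
have [bw|wb] := ltP b (h w).
  have hw0 : 0 < h w by lra.
  exists (ray S b); first exact: slice_nonempty.
  rewrite [w]ray_height// metric_sym; apply: ltW; apply: hrb => //.
    by rewrite hw0; have /andP[] := height_range w.
  by rewrite distrC ger0_norm; lra.
by exists w; [rewrite /slice/= aw|rewrite mdistxx ltW].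
Qed.

(** The heights on [M_ n] tend to 0, so the shadows have the same limit as the [M_ n]. Enlargements
    of the shadows lift to enlargements of the [M_ n] with the same limit, to which maximality in
    the spiral applies. *)
Lemma remainder_maximal_limit K M : (forall y, K y -> h y = 0) ->
  maximal_limit_continuum K M ->
  maximal_limit_continuum ((inl : X -> Y) @^-1` K) (inl @^-1` M).
Proof.
move=> K0 [sM MK [M_ [sM_ cvM maxM]]].
have M0 y : M y -> h y = 0 by move=> /MK; exact: K0.
have [delta deltaP] := height_modulus.
have /choice[A_ A_P] n := shadow deltaP (sM_ n).
have small e : 0 < e -> exists N, forall n, (N <= n)%N -> forall y, M_ n y -> h y < delta e.
  move=> e0; have [d0 _ _] := deltaP e e0.
  have d20 : 0 < delta e / 2 by lra.
  have [N _ hN] := (hausdorff_cvgP M_ M).1 cvM _ d20.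
  exists N => n /hN cl y My.
  have := hclose_height (a := 0) (b := 0) cl _ My.
  have H w : M w -> 0 <= h w <= 0 by move=> /M0 ->; rewrite lexx.
  by move=> /(_ H); lra.
split; [exact: remainder_subcontinuum|by move=> a /MK|].
exists A_; split.
- by move=> n; have [] := A_P n.
- apply/hausdorff_cvgP => e e0; have e20 : 0 < e / 2 by lra.
  have [N1 hN1] := small _ e20.
  have [N2 _ hN2] := (hausdorff_cvgP M_ M).1 cvM _ e20.
  exists (maxn N1 N2) => // n /= Nn; apply/hclose_inl; rewrite (inl_preimageK M0).
  have -> : e = e / 2 + e / 2 by lra.
  apply: (hclose_trans (B := M_ n)); last by apply: hN2; exact: leq_trans (leq_maxr N1 N2) Nn.
  by have [_ h1 _] := A_P n; apply: h1 => //; apply: hN1; exact: leq_trans (leq_maxl N1 N2) Nn.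
move=> A'_ A' sA'_ sA' AA' cvA' A'K.
have /choice[M'_ M'P] n : exists M',
  [/\ subcontinuum M', M_ n `<=` M' &
       forall e, 0 < e -> (forall y, M_ n y -> h y < delta e) ->
         hclose e ((inl : X -> Y) @` A'_ n) M'].
  by have [_ _ h2] := A_P n; apply: h2.
rewrite -(maxM M'_ ((inl : X -> Y) @` A')).
- by apply/seteqP; split=> [a Aa|a [b Ab [<-]]//]; exists a.
- by move=> n; have [] := M'P n.
- exact: inl_subcontinuum.
- by move=> n; have [] := M'P n.
- apply/hausdorff_cvgP => e e0; have e20 : 0 < e / 2 by lra.
  have [N1 hN1] := small _ e20.
  have [N2 _ hN2] := (hausdorff_cvgP A'_ A').1 cvA' _ e20.
  exists (maxn N1 N2) => // n /= Nn.
  have -> : e = e / 2 + e / 2 by lra.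
  apply: (hclose_trans (B := (inl : X -> Y) @` A'_ n)).
    apply: hclose_sym; have [_ _ h1] := M'P n; apply: h1 => //.
    by apply: hN1; exact: leq_trans (leq_maxl N1 N2) Nn.
  by apply/hclose_inl; apply: hN2; exact: leq_trans (leq_maxr N1 N2) Nn.
- by move=> _ [a Aa <-]; exact: A'K.
Qed.

Lemma spiral_semi_Kelley : semi_Kelley X -> semi_Kelley (spiral_space S).
Proof.
move=> sKX K L M sK mL mM.
have [[y [Ky hy]]|flat] := pselect (exists y, K y /\ 0 < h y).
  have [a [b [a0 ab b0 b1 KE]]] := subcontinuum_slice sK Ky hy.
  rewrite KE in mL mM.
  by left; rewrite (slice_maximal_limit a0 ab b0 b1 mL) (slice_maximal_limit a0 ab b0 b1 mM).
have K0 y : K y -> h y = 0.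
  move=> Ky; have /andP[h1 _] := height_range y.
  apply/eqP; rewrite eq_le h1 andbT leNgt; apply/negP => hy.
  by apply: flat; exists y.
have L0 y : L y -> h y = 0 by have [_ LK _] := mL => /LK; exact: K0.
have M0 y : M y -> h y = 0 by have [_ MK _] := mM => /MK; exact: K0.
have [LM|ML] := sKX _ _ _ (remainder_subcontinuum sK K0)
  (remainder_maximal_limit K0 mL) (remainder_maximal_limit K0 mM).
- by left; rewrite -(inl_preimageK L0) -(inl_preimageK M0); exact: image_subset.
- by right; rewrite -(inl_preimageK L0) -(inl_preimageK M0); exact: image_subset.
Qed.

End SpiralTopology.

Theorem theorem4p4 (R : realType) (X : metricType R)
    (X_continuum : is_continuum X)
    (X_semi_Kelley : semi_Kelley X)
    (X_circularly_chainable : circularly_chainable X) :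
  semi_Kelley_remainder X.
Proof.
have [cX conX X2] := X_continuum.
have [x [eta [etaP denseP traceP]]] := tracking cX conX X2 X_circularly_chainable.
have [D _ DP] := compact_bounded cX X2.
pose S := Spiral x DP.
exists (spiral_space S), [set y | 0 < height y], [set y | height y = 0].
split.
- exact: (spiral_compactification cX (S := S) etaP denseP traceP).
- exact: (spiral_semi_Kelley cX conX (S := S) etaP denseP traceP X_semi_Kelley).
- exact: remainder_homeomorphic.
Qed.
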